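(* For each integer $3\le q\le 9$ there exists an integer $m_0(q)$ such that the following holds. For every integer $m\ge m_0(q)$, let $d_{q,m}:=2+\frac{q-2}{m}$. Then there exist a constant $\varepsilon_{q,m}>0$ and infinitely many connected graphs $G$ of average degree $d_{q,m}$ such that, writing $n=|V(G)|$, \[ \frac{\lambda_2(G)}{\lambda_n(G)}>\frac{d_{q,m}-2\sqrt{d_{q,m}-1}}{d_{q,m}+2\sqrt{d_{q,m}-1}}+\varepsilon_{q,m}. \]
   Context: All graphs are finite and simple. For a graph $G$ on $n$ vertices, $L_G=D_G-A_G$ is its Laplacian matrix ($D_G$ the diagonal degree matrix, $A_G$ the adjacency matrix), with eigenvalues $0=\lambda_1(G)\le\lambda_2(G)\le\cdots\le\lambda_n(G)$. The average degree of $G$ is $2|E(G)|/|V(G)|$. *)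

(* Defs.v *)
From HB Require Import structures.
From mathcomp Require Import all_boot all_order all_algebra all_fingroup.
From mathcomp Require Import spectral complex.
From mathcomp Require Import all_classical reals.

Set Implicit Arguments.
Unset Strict Implicit.
Unset Printing Implicit Defensive.

Import Order.TTheory GRing.Theory Num.Theory.
Local Open Scope ring_scope.

(* Every vertex set is some 'I_n, so each order carries only finitely many
   graphs and each finite graph has only finitely many labelled copies: a set
   of graphs closed under isomorphism is infinite iff it contains infinitely
   many isomorphism classes. *)
Record sgraph := SGraph {
  nverts : nat;
  adj : 'I_nverts -> 'I_nverts -> bool;
  adj_sym : symmetric adj;
  adj_irr : irreflexive adj
}.

Definition degree (G : sgraph) (x : 'I_(nverts G)) : nat :=
  #|[set y | adj x y]|.

Definition edges (G : sgraph) : {set {set 'I_(nverts G)}} :=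
  [set e | [exists x, exists y, adj x y && (e == [set x; y])]].

Definition connected_graph (G : sgraph) : Prop :=
  (0 < nverts G)%N /\ forall x y : 'I_(nverts G), connect (@adj G) x y.

Section RealData.
Variable R : realType.

Definition average_degree (G : sgraph) : R :=
  2 * #|edges G|%:R / (nverts G)%:R.

Definition degree_mx (G : sgraph) : 'M[R]_(nverts G) :=
  diag_mx (\row_x (degree x)%:R).

Definition adjacency_mx (G : sgraph) : 'M[R]_(nverts G) :=
  \matrix_(x, y) (adj x y)%:R.

Definition laplacian (G : sgraph) : 'M[R]_(nverts G) :=
  degree_mx G - adjacency_mx G.

Definition sorted_spectrum n (A : 'M[R]_n) (s : seq R) : Prop :=
  sorted <=%R s /\ char_poly A = \prod_(a <- s) ('X - a%:P).

(* The eigenvalues of A in nondecreasing order, counted with (algebraic)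
   multiplicity; the default [::] is never reached for symmetric A. *)
Definition eigenvalues n (A : 'M[R]_n) : seq R :=
  xget [::] [set s | sorted_spectrum A s].

Lemma sorted_spectrum_inj n (A : 'M[R]_n) s t :
  sorted_spectrum A s -> sorted_spectrum A t -> s = t.
Proof.
move=> [ss es] [st et].
apply: (sorted_eq le_trans le_anti) => //.
by apply: prod_XsubC_eq; rewrite -es.
Qed.

Lemma size_sorted_spectrum n (A : 'M[R]_n) s : sorted_spectrum A s -> size s = n.
Proof.
by case=> _ e; have := size_char_poly A; rewrite e size_prod_XsubC => -[].
Qed.

Lemma symmetric_sorted_spectrum n (A : 'M[R]_n) :
  A^T = A -> exists s, sorted_spectrum A s.
Proof.
move=> symA.
pose f : {rmorphism R -> R[i]} := real_complex R.
pose B : 'M[R[i]]_n := map_mx f A.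
have hB : B \is hermsymmx.
  apply: realsym_hermsym.
    by apply/is_hermitianmxP; rewrite expr0 scale1r map_mx_id // map_trmx symA.
  by apply/mxOverP => i j; rewrite mxE; apply/complex_realP; exists (A i j).
have /orthomx_spectralP BE := hermitian_normalmx hB.
have [d dE] : exists d : 'rV[R]_n, spectral_diag B = map_mx f d.
  exists (\row_j complex.Re (spectral_diag B 0 j)).
  apply/rowP => j; rewrite !mxE.
  have /mxOverP/(_ 0 j) := hermitian_spectral_diag_real hB.
  by move=> /RRe_real.
set P := spectralmx B in BE.
have Pu : P \in unitmx := spectral_unit B.
have cB : char_poly B = char_poly (map_mx f (diag_mx d)).
  pose Q := map_mx polyC P; pose Q' := map_mx polyC (invmx P).
  have Q'Q : Q' *m Q = 1%:M by rewrite -map_mxM /= mulVmx // map_mx1.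
  rewrite BE dE -map_diag_mx /char_poly /char_poly_mx.
  have -> : 'X%:M - map_mx polyC (invmx P *m map_mx f (diag_mx d) *m P)
            = Q' *m ('X%:M - map_mx polyC (map_mx f (diag_mx d))) *m Q.
    rewrite mulmxBr mulmxBl !map_mxM /= -/Q -/Q'; congr (_ - _).
    by rewrite scalar_mxC -mulmxA Q'Q mulmx1.
  rewrite !det_mulmx mulrAC -det_mulmx Q'Q det1 mul1r //.
exists (sort <=%R [seq d 0 j | j <- enum 'I_n]); split.
  exact: (sort_sorted le_total).
rewrite (perm_big _ (permEl (perm_sort _ _))) /= big_map big_enum /=.
apply: (@map_poly_inj _ _ f); rewrite map_char_poly -/B cB -map_char_poly.
congr map_poly.
rewrite char_poly_trig ?diag_mx_is_trig //.
by apply: eq_bigr => j _; rewrite mxE eqxx mulr1n.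
Qed.

Lemma laplacian_sym (G : sgraph) : (laplacian G)^T = laplacian G.
Proof.
apply/matrixP => x y; rewrite !mxE adj_sym; congr (_ - _).
by case: (eqVneq y x) => [->|_]; rewrite ?eqxx ?mulr0n.
Qed.

Lemma laplacian_eigenvaluesP (G : sgraph) :
  sorted_spectrum (laplacian G) (eigenvalues (laplacian G)).
Proof.
have [s hs] := symmetric_sorted_spectrum (laplacian_sym G).
exact: (xgetI [::] hs).
Qed.

(* lambda G i is the i-th smallest Laplacian eigenvalue, with i starting at 1
   as in lambda_1(G) <= ... <= lambda_n(G). *)
Definition lambda (G : sgraph) (i : nat) : R :=
  nth 0 (eigenvalues (laplacian G)) i.-1.

End RealData.

(* Main.v *)
(** Let V carry k permutations with expansion ratio 1/20, where q-2 divides k-1.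
    Replace every vertex of V by a path of k vertices (the gadget), and join the
    i-th gadget vertices of v and sigma_i v by a path of about 2m/(q-2) edges.  All
    degrees are at most 4, so lambda_n <= 8, and the lengths can be chosen to make
    the average degree exactly 2 + (q-2)/m.  With l = ((q-2)/m)^2 / 2, a path of
    L <= 2m/(q-2) edges has energy minus l times its interior mass at least
    (D (x^2 + y^2) - 2 x y) / S in terms of its end values x, y, where S has the
    order of L and D is close to cos (sqrt 2) > 1/8.  As 1/20 < D, the sum over all
    paths is positive when the values have mean zero on V and are constant on
    gadgets; for large m the gadget energy dominates the deviations from that,
    hence lambda_2 >= l.  So the ratio is at least delta^2 / 16 with
    delta = (q-2)/m, and the bound to beat is delta^2 / (1 + sqrt (1 + delta))^4.

    The expander is of Gabber-Galil type over 'F_2[X]: under the Walsh transform,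
    its shears act on pairs of polynomials and are controlled by the degrees, and
    translations control the pairs of top degree.  Words in these 13 permutations
    then make the ratio as small as needed. *)
Require Import Defs.
From mathcomp Require Import all_boot all_order all_algebra all_fingroup.
From mathcomp Require Import spectral complex.
From mathcomp Require Import all_classical reals.
From mathcomp Require Import ring lra zify.
Set Implicit Arguments.
Unset Strict Implicit.
Unset Printing Implicit Defensive.
Import Order.TTheory GRing.Theory Num.Theory.
Local Open Scope ring_scope.

(** * Energy of a path minus [l] times its interior mass *)

Section Path.
Variables (R : realFieldType) (l : R).

(** The second component solves the eigenvalue recurrence u_{j+1} - 2 u_j + u_{j-1} = - l u_j of a
    path from u_0 = 0, u_1 = 1, and the first is its backward difference. For l = 2 - 2 cos t they
    are cos ((j - 1/2) t) / cos (t/2) and sin (j t) / sin t. *)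
Fixpoint cheb (j : nat) : R * R :=
  if j is j'.+1 then
    let: (a, b) := cheb j' in (a - l * b, b + (a - l * b))
  else (1, 0).

Definition chebD j := (cheb j).1.
Definition chebS j := (cheb j).2.

Lemma chebD0 : chebD 0 = 1. Proof. by []. Qed.
Lemma chebS0 : chebS 0 = 0. Proof. by []. Qed.
Lemma chebDS j : chebD j.+1 = chebD j - l * chebS j.
Proof. by rewrite /chebD /chebS /=; case: (cheb j). Qed.
Lemma chebSS j : chebS j.+1 = chebS j + chebD j.+1.
Proof. by rewrite /chebD /chebS /=; case: (cheb j). Qed.

(** A discrete Wronskian, constant along the recurrence. *)
Lemma cheb_det j : chebD j * chebS j.+1 - chebD j.+1 * chebS j = 1.
Proof.
elim: j => [|j IH]; first by rewrite chebSS chebDS chebD0 chebS0; ring.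
by rewrite -IH chebSS [chebD j.+2]chebDS chebSS; rewrite [chebD j.+1]chebDS; ring.
Qed.

(** Elimination of the interior value [y]: the right side is quadratic in [y] with leading
    coefficient S'/S and minimum at S' y = x + S z, and the determinant identity makes that minimum
    the left side. *)
Lemma path_step (D S D' S' x y z : R) : D' = D - l * S -> S' = S + D' ->
  0 < S -> 0 < S' -> D * S' - D' * S = 1 ->
  (D' * (x ^+ 2 + z ^+ 2) - 2 * x * z) / S' <=
  (D * (x ^+ 2 + y ^+ 2) - 2 * x * y) / S - l * y ^+ 2 + (z - y) ^+ 2.
Proof.
move=> eD' eS' S0 S'0 det.
have Sn : S != 0 by rewrite gt_eqF.
have S'n : S + (D - l * S) != 0 by rewrite -eD' -eS' gt_eqF.
rewrite -subr_ge0.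
set rhs := (X in 0 <= X).
have -> : rhs = (S' * y - x - S * z) ^+ 2 / (S * S')
   + (D * S' - D' * S - 1) * x ^+ 2 / (S * S').
  by rewrite /rhs eS' eD'; field; rewrite S'n Sn.
by rewrite det subrr !mul0r addr0 divr_ge0 ?sqr_ge0 // mulr_ge0 // ltW.
Qed.

(** Interior values are eliminated one after the other by [path_step]; positivity of [chebS] keeps
    each quadratic convex. *)
Lemma path_form (f : nat -> R) L : (forall j, (j <= L)%N -> 0 < chebS j.+1) ->
  (chebD L.+1 * (f 0%N ^+ 2 + f L.+1 ^+ 2) - 2 * f 0%N * f L.+1) / chebS L.+1
  <= \sum_(0 <= j < L.+1) (f j.+1 - f j) ^+ 2 - l * \sum_(1 <= j < L.+1) f j ^+ 2.
Proof.
elim: L => [|L IH] S0.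
  rewrite big_nat1 big_geq // chebSS chebDS chebD0 chebS0 !mulr0 !subr0 add0r divr1.
  by rewrite le_eqVlt; apply/orP; left; apply/eqP; ring.
rewrite big_nat_recr //= [\sum_(1 <= j < L.+2) _]big_nat_recr //=.
have /IH {IH}IH : forall j, (j <= L)%N -> 0 < chebS j.+1.
  by move=> j jL; apply: S0; apply: leqW.
have SL : 0 < chebS L.+1 by apply: S0.
have SL1 : 0 < chebS L.+2 by apply: S0.
have := path_step (f 0%N) (f L.+1) (f L.+2) (chebDS _) (chebSS _) SL SL1
  (cheb_det _).
by lra.
Qed.

(* Shorter paths are padded to length [L.+1] by repeating their first value. *)
Lemma path_form_pad (f : nat -> R) L L' : 0 <= l -> (L' <= L)%N ->
  (forall j, (j <= L)%N -> 0 < chebS j.+1) ->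
  (chebD L.+1 * (f 0%N ^+ 2 + f L'.+1 ^+ 2) - 2 * f 0%N * f L'.+1) / chebS L.+1
  <= \sum_(0 <= j < L'.+1) (f j.+1 - f j) ^+ 2 - l * \sum_(1 <= j < L'.+1) f j ^+ 2.
Proof.
move=> l0 LL S0; set r := (L - L')%N.
have eL : L.+1 = (r + L'.+1)%N by rewrite /r; lia.
have := @path_form (fun j => f (j - r)%N) L S0.
rewrite sub0n.
have -> : (L.+1 - r)%N = L'.+1 by lia.
have -> : \sum_(0 <= j < L.+1) (f (j.+1 - r)%N - f (j - r)%N) ^+ 2
        = \sum_(0 <= j < L'.+1) (f j.+1 - f j) ^+ 2.
  rewrite (big_cat_nat (n := r)) //=; last by rewrite eL leq_addr.
  rewrite big_nat big1 ?add0r; last first.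
    move=> j /andP[_ jr]; have -> : (j - r)%N = 0%N by lia.
    by have /eqP-> : (j.+1 - r == 0)%N; rewrite ?subn_eq0 // subrr expr0n.
  rewrite -{1}[r]add0n eL [(r + _)%N]addnC big_addn addnK.
  by apply: eq_bigr => j _; rewrite -addSn !addnK.
suff : \sum_(1 <= j < L'.+1) f j ^+ 2 <= \sum_(1 <= j < L.+1) f (j - r)%N ^+ 2.
  by move=> /(ler_wpM2l l0); lra.
rewrite (@big_cat_nat _ _ _ r.+1 1 L.+1) //=; last by lia.
rewrite -[leLHS]add0r lerD ?sumr_ge0 // => [? _|]; first exact: sqr_ge0.
have -> : L.+1 = (L'.+1 + r)%N by lia.
rewrite -[r.+1]add1n big_addn addnK.
by under [leRHS]eq_bigr => j _ do rewrite addnK.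
Qed.

Variable L : nat.
Hypotheses (l0 : 0 <= l) (lL : l * L%:R ^+ 2 <= 2).

(** The start of a chain of alternating bounds. Each, summed along the recurrence, gives the next
    partial sum of D_j = sum_i (-l)^i C(j+i-1, 2i) and S_j = sum_i (-l)^i C(j+i, 2i+1), the discrete
    cosine and sine series. Here [lL] keeps [chebD] nonnegative. *)
Lemma cheb_bounds1 j : (j <= L)%N ->
  [/\ chebD j <= 1, 0 <= chebS j, chebS j <= j%:R &
      1 - l * (j%:R * (j%:R - 1) / 2) <= chebD j].
Proof.
elim: j => [|j IH] jL.
  by rewrite chebD0 chebS0; split => //; rewrite !mul0r mulr0 subr0.
have {IH} [D1 S0 Sj Dj] := IH (ltnW jL).
have lS : l * chebS j <= l * j%:R by rewrite ler_wpM2l.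
have lS0 : 0 <= l * chebS j by rewrite mulr_ge0.
have Dj1 : 1 - l * (j.+1%:R * (j.+1%:R - 1) / 2) <= chebD j.+1.
  by rewrite chebDS -[j.+1%:R]natr1; lra.
have jL2 : j.+1%:R * (j.+1%:R - 1) <= L%:R ^+ 2 :> R.
  rewrite expr2 ler_pM ?ler0n ?subr_ge0 ?ler1n ?ler_nat //.
  by rewrite -natr1 addrK ler_nat ltnW.
have Dj0 : 0 <= chebD j.+1.
  apply: le_trans Dj1; move: (ler_wpM2l l0 jL2) lL.
  by move: (j.+1%:R : R) (L%:R ^+ 2 : R) => x y; lra.
by rewrite chebSS; split=> //; rewrite ?chebDS -?natr1 in Dj0 Dj1 *; lra.
Qed.

Lemma cheb_bounds2 j : (j <= L)%N ->
  j%:R - l * ((j%:R + 1) * j%:R * (j%:R - 1) / 6) <= chebS j.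
Proof.
elim: j => [|j IH] jL; first by rewrite chebS0; lra.
have := IH (ltnW jL); have [_ _ _ +] := cheb_bounds1 jL.
by rewrite chebSS -[j.+1%:R]natr1; lra.
Qed.

Lemma cheb_bounds3 j : (j <= L)%N ->
  chebD j <= 1 - l * (j%:R * (j%:R - 1) / 2)
    + l ^+ 2 * ((j%:R + 1) * j%:R * (j%:R - 1) * (j%:R - 2) / 24).
Proof.
elim: j => [|j IH] jL; first by rewrite chebD0; lra.
have := IH (ltnW jL); have := ler_wpM2l l0 (cheb_bounds2 (ltnW jL)).
by rewrite chebDS -[j.+1%:R]natr1; lra.
Qed.

Lemma cheb_bounds4 j : (j <= L)%N ->
  chebS j <= j%:R - l * ((j%:R + 1) * j%:R * (j%:R - 1) / 6)
    + l ^+ 2 * ((j%:R + 2) * (j%:R + 1) * j%:R * (j%:R - 1) * (j%:R - 2) / 120).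
Proof.
elim: j => [|j IH] jL; first by rewrite chebS0; lra.
have := IH (ltnW jL); have := cheb_bounds3 jL.
by rewrite chebSS -[j.+1%:R]natr1; lra.
Qed.

Lemma cheb_bounds5 j : (j <= L)%N ->
  1 - l * (j%:R * (j%:R - 1) / 2)
    + l ^+ 2 * ((j%:R + 1) * j%:R * (j%:R - 1) * (j%:R - 2) / 24)
    - l ^+ 3 * ((j%:R + 2) * (j%:R + 1) * j%:R * (j%:R - 1) * (j%:R - 2)
                * (j%:R - 3) / 720) <= chebD j.
Proof.
elim: j => [|j IH] jL; first by rewrite chebD0; lra.
have := IH (ltnW jL); have := ler_wpM2l l0 (cheb_bounds4 (ltnW jL)).
by rewrite chebDS -[j.+1%:R]natr1; lra.
Qed.

(* As [L] grows, the bound tends to the degree 6 Taylor polynomial of [cos]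
   at [sqrt 2], about [0.155]. *)
Lemma chebD_ge : (100 <= L)%N -> 1 / 8 <= chebD L.
Proof.
move=> L100; apply: le_trans (cheb_bounds5 (leqnn L)).
have : 100 <= L%:R :> R by rewrite (ler_nat R 100).
move: (L%:R : R) lL => x; set u := l * x ^+ 2 => u2 x100.
have u0 : 0 <= u by rewrite mulr_ge0 // sqr_ge0.
have x0 : 0 <= x by lra.
have h2 : l * (x * (x - 1) / 2) <= u / 2.
  by have := mulr_ge0 l0 x0; rewrite /u; lra.
(* The factor (1 + 1/x)(1 - 1/x)(1 - 2/x) exceeds 97/100 for x >= 100. *)
have h4 : u ^+ 2 * (97 / 100) <= l ^+ 2 * ((x + 1) * x * (x - 1) * (x - 2)).
  rewrite /u exprMn -[X in X <= _]mulrA ler_wpM2l ?sqr_ge0 //.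
  have : 0 <= x ^+ 3 * (x - 100) by rewrite mulr_ge0 ?exprn_ge0 //; lra.
  have : 0 <= x * (x ^+ 2 - x) by rewrite mulr_ge0 //; nra.
  by lra.
have h6 : l ^+ 3 * ((x + 2) * (x + 1) * x * (x - 1) * (x - 2) * (x - 3)) <= u ^+ 3.
  rewrite /u exprMn ler_wpM2l ?exprn_ge0 //.
  have -> : (x + 2) * (x + 1) * x * (x - 1) * (x - 2) * (x - 3)
     = x * (x - 3) * ((x ^+ 2 - 4) * (x ^+ 2 - 1)) by ring.
  have -> : (x ^+ 2) ^+ 3 = x ^+ 2 * (x ^+ 2 * x ^+ 2) by ring.
  have x24 : 4 <= x ^+ 2 by nra.
  by rewrite !ler_pM //; try nra; rewrite mulr_ge0 //; lra.
have : 1 / 8 <= 1 - u / 2 + u ^+ 2 * (97 / 100) / 24 - u ^+ 3 / 720 by nra.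
by lra.
Qed.

Hypothesis L100 : (100 <= L)%N.

Lemma chebD_ge_le j : (j <= L)%N -> chebD L <= chebD j.
Proof.
move=> jL; have : forall i, (j + i <= L)%N -> chebD (j + i) <= chebD j.
  elim=> [|i IH]; first by rewrite addn0.
  rewrite addnS => iL; apply: le_trans (IH (ltnW iL)).
  have [_ S0 _ _] := cheb_bounds1 (ltnW iL).
  by rewrite chebDS lerBlDr lerDl mulr_ge0.
by move=> /(_ (L - j)%N); rewrite subnKC // => ->.
Qed.

(** The increments of [chebS] are values of [chebD], which decreases down to [chebD L], at least
    1/8. *)
Lemma chebS_bounds j : (j <= L)%N -> j%:R / 8 <= chebS j <= j%:R.
Proof.
move=> jL; have [_ _ -> _] := cheb_bounds1 jL; rewrite andbT.
elim: j jL => [|j IH] jL; first by rewrite chebS0 mul0r.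
have := IH (ltnW jL); have := chebD_ge_le jL; have := chebD_ge L100.
by rewrite chebSS -[j.+1%:R]natr1; lra.
Qed.

End Path.

(** * The Walsh transform on pairs of vectors over the field with two elements *)

Section Walsh.
Variables (R : realFieldType) (n : nat).
Notation V := ('rV['F_2]_n * 'rV['F_2]_n)%type.
Implicit Types (x y c : V) (f g : V -> R).

Definition dot m (u v : 'rV['F_2]_m) : 'F_2 := (u *m v^T) 0 0.

Lemma dotDl m (u u' v : 'rV['F_2]_m) : dot (u + u') v = dot u v + dot u' v.
Proof. by rewrite /dot mulmxDl mxE. Qed.

Lemma dotDr m (u v v' : 'rV['F_2]_m) : dot u (v + v') = dot u v + dot u v'.
Proof. by rewrite /dot linearD mulmxDr mxE. Qed.

Lemma dotC m (u v : 'rV['F_2]_m) : dot u v = dot v u.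
Proof.
by rewrite /dot -[in RHS](trmxK (v *m u^T)) trmx_mul trmxK [RHS]mxE.
Qed.

Lemma dot_mulmx m (u v : 'rV['F_2]_m) A : dot u (v *m A) = dot (u *m A^T) v.
Proof. by rewrite /dot trmx_mul mulmxA. Qed.

Lemma dot_delta m (u : 'rV['F_2]_m) i : dot (delta_mx 0 i) u = u 0 i.
Proof. by rewrite /dot -rowE !mxE. Qed.

Definition sgn2 (u : 'F_2) : R := if u == 0 then 1 else -1.

Lemma F2P (u : 'F_2) : u = 0 \/ u = 1.
Proof. by case: u => [[|[|//]] ?]; [left | right]; apply/val_inj. Qed.

Lemma sgn2D u v : sgn2 (u + v) = sgn2 u * sgn2 v.
Proof.
by case: (F2P u) => ->; case: (F2P v) => ->; rewrite /sgn2 /= ?mulrNN ?mulr1 ?mul1r.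
Qed.

Lemma addF2 m k (A : 'M['F_2]_(m, k)) : A + A = 0.
Proof.
by apply/matrixP => i j; rewrite !mxE; case: (F2P (A i j)) => ->; apply/val_inj.
Qed.

Lemma addVV x : x + x = 0.
Proof. by case: x => a b; congr pair; apply: addF2. Qed.

Definition chi x y : R := sgn2 (dot x.1 y.1 + dot x.2 y.2).

Lemma chiC x y : chi x y = chi y x.
Proof. by rewrite /chi dotC [dot x.2 _]dotC. Qed.

Lemma chiDl x x' y : chi (x + x') y = chi x y * chi x' y.
Proof. by rewrite /chi /= !dotDl -sgn2D addrACA. Qed.

Lemma chi0 y : chi 0 y = 1.
Proof. by rewrite /chi /dot !mul0mx mxE addr0. Qed.

Lemma chi_sqr x y : chi x y * chi x y = 1.
Proof. by rewrite -chiDl addVV chi0. Qed.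

Lemma chi_le1 x y : -1 <= chi x y <= 1.
Proof. by rewrite /chi /sgn2; case: ifP => _; rewrite lexx ?lerN10; lra. Qed.

Lemma chi_nondegenerate y : y != 0 -> exists c, chi c y = -1.
Proof.
have key m (a : 'rV['F_2]_m) : a != 0 -> exists i, dot (delta_mx 0 i) a = 1.
  move=> /eqP a0; have [i ai] : exists i, a 0 i != 0.
    apply/existsP; rewrite -negb_forall; apply/negP => /forallP h; apply: a0.
    by apply/rowP => i; rewrite mxE; apply/eqP.
  by exists i; rewrite dot_delta; case: (F2P (a 0 i)) ai => ->.
case: y => a b; have [->|/key[i ai] _] := eqVneq a 0.
  have [->|/key[i bi] _] := eqVneq b 0; first by rewrite eqxx.
  by exists (0, delta_mx 0 i); rewrite /chi /= bi /dot mul0mx mxE.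
by exists (delta_mx 0 i, 0); rewrite /chi /= ai /dot mul0mx mxE.
Qed.

Lemma sum_shift f c : \sum_(x : V) f (x + c) = \sum_x f x.
Proof.
by rewrite [RHS](reindex_inj (addIr c)).
Qed.

Lemma sum_chi y : \sum_(x : V) chi x y = if y == 0 then #|{: V}|%:R else 0.
Proof.
case: eqVneq => [->|/chi_nondegenerate[c hc]].
  rewrite -[RHS]mulr1n -sumr_const; apply: eq_bigr => x _.
  by rewrite chiC chi0.
have : \sum_x chi x y = - \sum_x chi x y.
  rewrite -[LHS](sum_shift _ c) -sumrN.
  by apply: eq_bigr => x _; rewrite chiDl hc mulrN1.
by lra.
Qed.

Definition walsh f y : R := \sum_(x : V) f x * chi x y.

Lemma walsh_plancherel f g :
  \sum_y walsh f y * walsh g y = #|{: V}|%:R * \sum_x f x * g x.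
Proof.
transitivity (\sum_y \sum_x \sum_z (f x * g z) * chi (x + z) y).
  apply: eq_bigr => y _; rewrite big_distrlr /=; apply: eq_bigr => x _.
  by apply: eq_bigr => z _; rewrite chiDl; ring.
rewrite exchange_big /= mulr_sumr; apply: eq_bigr => x _.
rewrite exchange_big /= (bigD1 x) //= [X in _ + X]big1 ?addr0.
  rewrite -mulr_sumr; under eq_bigr => y _ do rewrite chiC.
  by rewrite sum_chi addVV eqxx mulrC.
move=> z zx; rewrite -mulr_sumr; under eq_bigr => y _ do rewrite chiC.
rewrite sum_chi; case: eqP => [xz|_]; rewrite ?mulr0 //.
case/eqP: zx; have : x + z + z = z by rewrite xz add0r.
by rewrite -addrA addVV addr0.
Qed.

Lemma walsh0 f : walsh f 0 = \sum_x f x.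
Proof. by apply: eq_bigr => x _; rewrite chiC chi0 mulr1. Qed.

Lemma walsh_dual f (s t : V -> V) : involutive s ->
  (forall x y, chi (s x) y = chi x (t y)) ->
  forall y, walsh (f \o s) y = walsh f (t y).
Proof.
move=> sK st y; rewrite /walsh [RHS](reindex_inj (inv_inj sK)) /=.
by apply: eq_bigr => x _; rewrite -st sK.
Qed.

Lemma walsh_shift f c y : walsh (fun x => f (x + c)) y = chi c y * walsh f y.
Proof.
rewrite /walsh -[X in chi c y * X](sum_shift _ c) mulr_sumr.
by apply: eq_bigr => x _; rewrite chiDl -[LHS]mulr1 -(chi_sqr c y); ring.
Qed.

Lemma sum_walsh_sqr f : \sum_(y : V) walsh f y ^+ 2 = #|{: V}|%:R * \sum_(x : V) f x ^+ 2.
Proof. exact: (walsh_plancherel f f). Qed.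

Lemma walsh_pairing f g (h : V -> V) (k : V -> R) (t : V -> V) :
  (forall y, walsh (g \o h) y = k y * walsh g (t y)) ->
  #|{: V}|%:R * \sum_(x : V) f x * g (h x) =
  \sum_(y : V) k y * (walsh f y * walsh g (t y)).
Proof.
move=> hk; rewrite -(walsh_plancherel f (g \o h)).
by apply: eq_bigr => y _; rewrite hk mulrCA.
Qed.

Definition shear1 (A : 'M['F_2]_n) x : V := (x.1 + x.2 *m A, x.2).
Definition shear2 (A : 'M['F_2]_n) x : V := (x.1, x.2 + x.1 *m A).

Lemma shear1K A : involutive (shear1 A).
Proof. by case=> a b; rewrite /shear1 /= -addrA addF2 addr0. Qed.

Lemma shear2K A : involutive (shear2 A).
Proof. by case=> a b; rewrite /shear2 /= -addrA addF2 addr0. Qed.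

(** The adjoint of a shear of one component is the transposed shear of the other; through
    [walsh_dual], shears act on frequencies as shears. *)
Lemma chi_shear1 A x y : chi (shear2 A^T x) y = chi x (shear1 A y).
Proof.
by rewrite /chi /= dotDl dotDr dot_mulmx; congr sgn2; rewrite addrAC addrA.
Qed.

Lemma chi_shear2 A x y : chi (shear1 A^T x) y = chi x (shear2 A y).
Proof.
by rewrite /chi /= dotDl dotDr dot_mulmx; congr sgn2; rewrite addrAC addrA.
Qed.

End Walsh.

(** * Degree weights for a Schur test *)

Section Weights.
Variable R : realFieldType.

(** Reciprocal weights for the two directions of a move between degrees: going up is cheap, going
    down is dear. *)
Definition gam (a b : nat) : R :=
  if (a < b)%N then 4 / 5 else if a == b then 1 else 5 / 4.

Lemma gam_gt0 a b : 0 < gam a b.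
Proof. by rewrite /gam; case: ifP => _; [|case: ifP => _]; lra. Qed.

Lemma gam_le a b : gam a b <= 5 / 4.
Proof. by rewrite /gam; case: ifP => _; [|case: ifP => _]; lra. Qed.

Lemma gamV a b : (gam a b)^-1 = gam b a.
Proof.
by rewrite /gam; case: ltngtP => _; rewrite ?invr1 ?invf_div.
Qed.

Lemma gamD2r c a b : gam (a + c) (b + c) = gam a b.
Proof. by rewrite /gam ltn_add2r eqn_add2r. Qed.

Lemma gamD2l c a b : gam (c + a) (c + b) = gam a b.
Proof. by rewrite /gam ltn_add2l eqn_add2l. Qed.

Variable F : fieldType.
Implicit Types p q : {poly F}.

Definition gamX p q s := gam (size p) (size (p + q * 'X^s)).

(* A shear by the larger polynomial increases the degree; a shear by the smaller
   one can decrease it only when the leading terms meet, so for at most one [s]. *)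
Lemma gamX_sum p q : (p != 0) || (q != 0) ->
  gamX p q 1 + gamX p q 2 + (gamX q p 1 + gamX q p 2) <= 77 / 20.
Proof.
wlog le : p q / (size p <= size q)%N => [hw|pq0].
  move=> pq; case: (leqP (size p) (size q)) => [/hw|/ltnW/hw]; first exact.
  by rewrite orbC => /(_ pq); rewrite [leLHS]addrC.
have q0 : q != 0.
  apply: contraTneq pq0 => q0; move: le; rewrite q0 size_poly0 leqn0 size_poly_eq0.
  by move=> ->; rewrite eqxx.
have size_polyDr (r t : {poly F}) :
    (size r < size t)%N -> size (r + t) = size t.
  by rewrite addrC; apply: size_polyDl.
have big (r t : {poly F}) s : (size r <= size t)%N -> t != 0 -> gamX r t s.+1 = 4 / 5.
  move=> rt t0; have st : size (t * 'X^(s.+1)) = (s.+1 + size t)%N.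
    by rewrite size_mulXn.
  rewrite /gamX size_polyDr st ?addSn ?ltnS; last by rewrite (leq_trans rt) ?leq_addl.
  by rewrite /gam ltnS (leq_trans rt) ?leq_addl.
rewrite !(big p q) //.
have [p0|p0] := eqVneq p 0.
  by rewrite /gamX p0 !mul0r !addr0 /gam ltnn eqxx; lra.
move: le; rewrite leq_eqVlt => /orP[/eqP e|lt].
  by rewrite !big ?e //; lra.
have sp s : size (p * 'X^s) = (s + size p)%N by rewrite size_mulXn.
have up s : (size q < s + size p)%N -> gamX q p s = 4 / 5.
  by move=> h; rewrite /gamX size_polyDr sp // /gam h.
have same s : (s + size p < size q)%N -> gamX q p s = 1.
  by move=> h; rewrite /gamX size_polyDl ?sp // /gam ltnn eqxx.
case: (ltngtP (size q) (1 + size p)) => h1.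
- by rewrite !up //; [lra | apply: leq_trans h1 _; rewrite leq_add2r].
(* The extremal case: 4/5 + 4/5 + 1 + 5/4 = 77/20. *)
- rewrite (same 1) //; have := gam_le (size q) (size (q + p * 'X^2)).
  by rewrite -/(gamX q p 2); lra.
rewrite (up 2); last by rewrite h1.
have := gam_le (size q) (size (q + p * 'X^1)).
by rewrite -/(gamX q p 1); lra.
Qed.

End Weights.

(** * Thirteen permutations of pairs of truncated polynomials *)

Section Expander.
Variables (R : realFieldType) (n' : nat).
Notation n := n'.+2.
Notation V := ('rV['F_2]_n * 'rV['F_2]_n)%type.

(** Multiplication by X^s with the coefficients from degree [n] on cut off. It is exact for s <= 2
    when the two top coefficients vanish. *)
Definition shift_mx s : 'M['F_2]_n := \matrix_(i, j) (j == (i + s)%N :> nat)%:R.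

Lemma rVpoly_shift (a : 'rV['F_2]_n) s : (size (rVpoly a) <= n')%N -> (s <= 2)%N ->
  rVpoly (a *m shift_mx s) = rVpoly a * 'X^s.
Proof.
move=> sa s2; apply/polyP => i; rewrite coefMXn.
have [ni|ni] := leqP n i.
  rewrite coef_rVpoly; case: insubP => [j|_]; first by rewrite ltnNge ni.
  by case: ifP => // _; rewrite nth_default // (leq_trans sa); lia.
rewrite -[X in _`_X]/(nat_of_ord (Ordinal ni)) coef_rVpoly_ord mxE /=.
case: ltnP => si.
  rewrite big1 // => j _; rewrite mxE /=; case: eqP => [e|_]; last by rewrite mulr0.
  by move: si; rewrite e ltnNge leq_addl.
have ji : (i - s < n)%N by lia.
rewrite (bigD1 (Ordinal ji)) //= big1 ?addr0 => [|j jn].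
  rewrite mxE /= subnK // eqxx mulr1.
  by rewrite -[X in _`_X]/(nat_of_ord (Ordinal ji)) coef_rVpoly_ord.
rewrite mxE /=; case: eqP => [e|_]; last by rewrite mulr0.
by case/eqP: jn; apply/val_inj; rewrite /= e addnK.
Qed.

Definition top1 : 'I_n := ord_max.
Definition top2 : 'I_n := inord n'.

Lemma size_rVpoly_top (a : 'rV['F_2]_n) :
  a 0 top1 = 0 -> a 0 top2 = 0 -> (size (rVpoly a) <= n')%N.
Proof.
move=> a1 a2; apply/leq_sizeP => i ni.
rewrite coef_rVpoly; case: insubP => // j _ ji.
have : i = n' \/ i = n'.+1 by move: (ltn_ord j); rewrite [nat_of_ord j]ji => ij; lia.
case=> e; [rewrite -a2 | rewrite -a1]; congr (a 0 _); apply/val_inj.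
  by rewrite ji e /top2 /= inordK.
by rewrite ji e.
Qed.

Definition tops : seq V :=
  [:: (delta_mx 0 top1, 0); (delta_mx 0 top2, 0);
      (0, delta_mx 0 top1); (0, delta_mx 0 top2)].

Definition dual_shears : seq (V -> V) :=
  [:: shear1 (shift_mx 1); shear1 (shift_mx 2);
      shear2 (shift_mx 1); shear2 (shift_mx 2)].

(** A shear changes only one of the two sizes, so [gam] of the sums is [gam] of that size. *)
Definition wt (y : V) := (size (rVpoly y.1) + size (rVpoly y.2))%N.

Lemma chi_tops_sum (y : V) :
  (exists2 c, c \in tops & chi R c y = -1) \/
  (size (rVpoly y.1) <= n')%N /\ (size (rVpoly y.2) <= n')%N.
Proof.
have chi1 i : chi R (delta_mx 0 i, 0) y = sgn2 R (y.1 0 i).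
  by rewrite /chi /= dot_delta /dot mul0mx mxE addr0.
have chi2 i : chi R (0, delta_mx 0 i) y = sgn2 R (y.2 0 i).
  by rewrite /chi /= dot_delta /dot mul0mx mxE add0r.
case: (F2P (y.1 0 top1)) => e1; last first.
  by left; exists (delta_mx 0 top1, 0); rewrite ?chi1 ?e1 // !inE eqxx ?orbT.
case: (F2P (y.1 0 top2)) => e2; last first.
  by left; exists (delta_mx 0 top2, 0); rewrite ?chi1 ?e2 // !inE eqxx ?orbT.
case: (F2P (y.2 0 top1)) => e3; last first.
  by left; exists (0, delta_mx 0 top1); rewrite ?chi2 ?e3 // !inE eqxx ?orbT.
case: (F2P (y.2 0 top2)) => e4; last first.
  by left; exists (0, delta_mx 0 top2); rewrite ?chi2 ?e4 // !inE eqxx ?orbT.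
by right; split; apply: size_rVpoly_top.
Qed.

Definition wgt (t : V -> V) y : R := gam R (wt y) (wt (t y)).

Lemma rVpoly_eq0 m (a : 'rV['F_2]_m) : (rVpoly a == 0) = (a == 0).
Proof.
by apply/eqP/eqP => [h|->]; [rewrite -[a]rVpolyK h linear0 | rewrite linear0].
Qed.

(** The row sums of the Schur test. If a top coefficient of [y] is nonzero, some translation has
    sign -1 and the sum is at most 5 + 2 + 4 * 5/4 = 12. Otherwise the shears multiply without
    truncation, and [gamX_sum] gives 5 + 4 + 77/20 = 257/20. *)
Lemma wgt_sum y : y != 0 ->
  5 + \sum_(c <- tops) chi R c y + \sum_(t <- dual_shears) wgt t y <= 257 / 20.
Proof.
move=> y0; have h z : chi R z y <= 1 by case/andP: (chi_le1 R z y).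
have sum4 (x a b c d : R) : a <= x -> b <= x -> c <= x -> d <= x ->
    a + (b + (c + (d + 0))) <= 4 * x by lra.
case: (chi_tops_sum y) => [[c cin ec]|[s1 s2]].
  have sumw : \sum_(t <- dual_shears) wgt t y <= 4 * (5 / 4).
    by rewrite !big_cons big_nil; apply: sum4; apply: gam_le.
  have sumc : \sum_(c <- tops) chi R c y <= 2.
    have aux (x1 x2 x3 x4 : R) : x1 <= 1 -> x2 <= 1 -> x3 <= 1 -> x4 <= 1 ->
        [\/ x1 = -1, x2 = -1, x3 = -1 | x4 = -1] -> x1 + (x2 + (x3 + (x4 + 0))) <= 2.
      by move=> ? ? ? ? []; lra.
    rewrite !big_cons big_nil; apply: aux => //; rewrite -ec.
    move: cin; rewrite !in_cons in_nil orbF.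
    by move=> /or4P[] /eqP->; [constructor 1|constructor 2|constructor 3|constructor 4].
  by move: sumc sumw; move: (\sum_(c <- tops) _) (\sum_(t <- dual_shears) _) => A B; lra.
have e1 s : (s.+1 <= 2)%N ->
    wgt (shear1 (shift_mx s.+1)) y = gamX R (rVpoly y.1) (rVpoly y.2) s.+1.
  by move=> s_le; rewrite /wgt /wt /= gamD2r linearD /= rVpoly_shift //; lia.
have e2 s : (s.+1 <= 2)%N ->
    wgt (shear2 (shift_mx s.+1)) y = gamX R (rVpoly y.2) (rVpoly y.1) s.+1.
  by move=> s_le; rewrite /wgt /wt /= gamD2l linearD /= rVpoly_shift //; lia.
have : (rVpoly y.1 != 0) || (rVpoly y.2 != 0).
  rewrite !rVpoly_eq0 -negb_and; apply: contra y0 => /andP[/eqP a0 /eqP b0].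
  by rewrite [y]surjective_pairing a0 b0.
move=> /(gamX_sum R).
have : \sum_(c <- tops) chi R c y <= 4 * 1.
  by rewrite !big_cons big_nil; apply: sum4.
move: (\sum_(c <- tops) _) => A; rewrite !big_cons big_nil !e1 // !e2 //.
move: (gamX _ _ _ 1) => w1; move: (gamX _ _ _ 2) => w2.
by move: (gamX _ _ _ 1) (gamX _ _ _ 2) => w3 w4; lra.
Qed.

Definition involP (h : V -> V) (hK : involutive h) : {perm V} := perm (inv_inj hK).

Lemma addVK (c : V) : involutive (fun x => x + c).
Proof. by move=> x; rewrite -addrA addVV addr0. Qed.

(** Five identities keep the multiplier 5 + sum of four signs nonnegative and bring the number of
    permutations to 13. *)
Definition base_perms : seq {perm V} :=
  nseq 5 1%g ++ [seq involP (addVK c) | c <- tops] ++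
  [:: involP (shear2K (shift_mx 1)^T); involP (shear2K (shift_mx 2)^T);
      involP (shear1K (shift_mx 1)^T); involP (shear1K (shift_mx 2)^T)].

(** On the Walsh side identities and translations are diagonal and shears permute the frequencies,
    so [wgt_sum] bounds the form frequency by frequency; mean zero removes the frequency 0. *)
Lemma base_expander (f g : V -> R) : \sum_x f x = 0 -> \sum_x g x = 0 ->
  \sum_(s <- base_perms) \sum_x f x * g (s x) <=
  257 / 20 * ((\sum_x f x ^+ 2 + \sum_x g x ^+ 2) / 2).
Proof.
move=> f0 g0; set F := walsh f; set G := walsh g.
have F0 : F 0 = 0 by rewrite /F walsh0.
have G0 : G 0 = 0 by rewrite /G walsh0.
have V0 : 0 < #|{: V}|%:R :> R by rewrite ltr0n; apply/card_gt0P; exists 0.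
rewrite -(ler_pM2l V0).
have e1 : #|{: V}|%:R * \sum_x f x * g ((1 : {perm V})%g x) = \sum_y F y * G y.
  by rewrite walsh_plancherel; congr (_ * _); apply: eq_bigr => x _; rewrite perm1.
have e2 c : #|{: V}|%:R * \sum_x f x * g (involP (addVK c) x) =
    \sum_y chi R c y * (F y * G y).
  rewrite -(@walsh_pairing R n f g (fun x => x + c) (chi R c) id); last first.
    by move=> y; apply: walsh_shift.
  by congr (_ * _); apply: eq_bigr => x _; rewrite permE.
have e3 h (hK : involutive h) t : (forall x y, chi R (h x) y = chi R x (t y)) ->
    #|{: V}|%:R * \sum_x f x * g (involP hK x) = \sum_y F y * G (t y).
  move=> ht; transitivity (\sum_y 1 * (F y * G (t y))); last first.
    by apply: eq_bigr => y _; rewrite mul1r.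
  rewrite -(@walsh_pairing R n f g h (fun=> 1) t); last first.
    by move=> y; rewrite mul1r; apply: walsh_dual.
  by congr (_ * _); apply: eq_bigr => x _; rewrite permE.
have FF : \sum_y F y ^+ 2 = #|{: V}|%:R * \sum_x f x ^+ 2 := sum_walsh_sqr f.
have GG : \sum_y G y ^+ 2 = #|{: V}|%:R * \sum_x g x ^+ 2 := sum_walsh_sqr g.
clearbody F G.
have -> : #|{: V}|%:R * \sum_(s <- base_perms) \sum_x f x * g (s x)
   = \sum_y (5 + \sum_(c <- tops) chi R c y) * (F y * G y)
     + \sum_(t <- dual_shears) \sum_y F y * G (t y).
  have -> : \sum_y (5 + \sum_(c <- tops) chi R c y) * (F y * G y)
     = 5 * (\sum_y F y * G y) + \sum_(c <- tops) \sum_y chi R c y * (F y * G y).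
    rewrite exchange_big mulr_sumr -big_split /=.
    by apply: eq_bigr => y _; rewrite mulrDl mulr_suml.
  rewrite /base_perms /tops /dual_shears /= !big_cons !big_nil !mulrDr !addr0.
  rewrite !e1 !e2 !(e3 _ _ _ (@chi_shear1 R n _)) !(e3 _ _ _ (@chi_shear2 R n _)).
  by ring.
have le2 (a b : R) : a * b <= (a ^+ 2 + b ^+ 2) / 2.
  by have := sqr_ge0 (a - b); lra.
have w_le t : involutive t ->
    \sum_y F y * G (t y) <= \sum_y wgt t y * ((F y ^+ 2 + G y ^+ 2) / 2).
  move=> tK.
  (* Uses a b <= (w a^2 + b^2 / w) / 2 with w = [wgt t y]. As [t] is an involution, 1/w is the
     weight at [t y], so reindexing collects both squares at the same frequency. *)
  apply: (@le_trans _ _ (\sum_y (wgt t y * (F y ^+ 2 / 2)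
                               + wgt t (t y) * (G (t y) ^+ 2 / 2)))); last first.
    rewrite big_split /= [leRHS](eq_bigr (fun y => wgt t y * (F y ^+ 2 / 2)
      + wgt t y * (G y ^+ 2 / 2))) => [|y _]; last by rewrite mulrDl mulrDr.
    by rewrite big_split /= lerD2l [leRHS](reindex_inj (inv_inj tK)).
  apply: ler_sum => y _; rewrite [wgt t (t y)]/wgt tK -gamV -/(wgt t y).
  have := gam_gt0 R (wt y) (wt (t y)); rewrite -/(wgt t y); move: (wgt t y) => w w0.
  rewrite -subr_ge0; set e := (X in 0 <= X).
  have -> : e = (w * F y - G (t y)) ^+ 2 / (2 * w).
    by rewrite /e; field; rewrite gt_eqF.
  by rewrite divr_ge0 ?sqr_ge0 // mulr_ge0 // ltW.
apply: (@le_trans _ _ (\sum_y (5 + \sum_(c <- tops) chi R c y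
    + \sum_(t <- dual_shears) wgt t y) * ((F y ^+ 2 + G y ^+ 2) / 2))).
  under [leRHS]eq_bigr => y _ do rewrite mulrDl.
  rewrite big_split lerD //=.
    apply: ler_sum => y _; rewrite ler_wpM2l // !big_cons big_nil.
    have aux (x1 x2 x3 x4 : R) : -1 <= x1 -> -1 <= x2 -> -1 <= x3 -> -1 <= x4 ->
        0 <= 5 + (x1 + (x2 + (x3 + (x4 + 0)))) by lra.
    have h z : -1 <= chi R z y by case/andP: (chi_le1 R z y).
    exact: aux.
  under [leRHS]eq_bigr => y _ do rewrite mulr_suml.
  rewrite [leRHS]exchange_big /= !big_cons !big_nil.
  by rewrite !lerD // w_le //; do ?[exact: shear1K | exact: shear2K].
have -> : #|{: V}|%:R * (257 / 20 * ((\sum_x f x ^+ 2 + \sum_x g x ^+ 2) / 2))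
   = \sum_y 257 / 20 * ((F y ^+ 2 + G y ^+ 2) / 2).
  by rewrite -mulr_sumr -mulr_suml big_split /= FF GG; ring.
apply: ler_sum => y _; have [->|y0] := eqVneq y 0.
  by rewrite F0 G0 expr0n addr0 mul0r !mulr0.
by rewrite ler_wpM2r ?wgt_sum // divr_ge0 // addr_ge0 ?sqr_ge0.
Qed.

End Expander.

(** * Norm of sums of permutations and of their words *)

Section Words.
Variables (R : realFieldType) (V : finType).
Implicit Types (S W : seq {perm V}) (f g : V -> R).

Definition perm_sum S f x : R := \sum_(s <- S) f (s x).

Definition norm_bound S (nu : R) := forall f, \sum_x f x = 0 ->
  \sum_x perm_sum S f x ^+ 2 <= nu ^+ 2 * \sum_x f x ^+ 2.

Lemma perm_sum_mean0 S f : \sum_x f x = 0 -> \sum_x perm_sum S f x = 0.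
Proof.
move=> f0; rewrite exchange_big big1_seq // => s _.
by rewrite -[RHS]f0 [RHS](reindex_inj (@perm_inj _ s)).
Qed.

(** The bilinear bound is tested on [perm_sum S f] divided by [nu] against [f]. Unlike a bound on
    the quadratic form, the resulting operator norm bound is multiplicative over words. *)
Lemma norm_bound_bilinear S (nu : R) : 0 < nu ->
  (forall f g, \sum_x f x = 0 -> \sum_x g x = 0 ->
    \sum_(s <- S) \sum_x f x * g (s x) <=
    nu * ((\sum_x f x ^+ 2 + \sum_x g x ^+ 2) / 2)) ->
  norm_bound S nu.
Proof.
move=> nu0 hS f f0; have := hS (fun x => nu^-1 * perm_sum S f x) f.
rewrite -mulr_sumr perm_sum_mean0 // mulr0 => /(_ erefl f0).
rewrite exchange_big /=.
under eq_bigr => x _ do rewrite -mulr_sumr -/(perm_sum S f x) -mulrA -expr2.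
under [X in _ <= _ * ((X + _) / _)]eq_bigr => x _ do rewrite exprMn.
rewrite -!mulr_sumr; set A := \sum_x _; set B := \sum_x _ => h.
have := ler_wpM2l (ltW nu0) h.
have -> : nu * (nu^-1 * A) = A by rewrite mulVKf ?gt_eqF.
have -> : nu * (nu * ((nu^-1 ^+ 2 * A + B) / 2)) = (A + nu ^+ 2 * B) / 2.
  by field; rewrite gt_eqF.
by lra.
Qed.

Fixpoint words S t : seq {perm V} :=
  if t is t'.+1 then [seq (s * w)%g | s <- S, w <- words S t'] else [:: 1%g].

Lemma size_words S t : size (words S t) = (size S ^ t)%N.
Proof. by elim: t => //= t IH; rewrite size_allpairs IH expnS. Qed.

Lemma perm_sum_words S t f x :
  perm_sum (words S t.+1) f x = perm_sum S (perm_sum (words S t) f) x.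
Proof.
rewrite /perm_sum /= big_allpairs_dep /=.
by apply: eq_bigr => s _; apply: eq_bigr => w _; rewrite permM.
Qed.

Lemma norm_bound_words S (nu : R) t : norm_bound S nu -> norm_bound (words S t) (nu ^+ t).
Proof.
move=> hS; elim: t => [|t IH] f f0.
  rewrite expr0 expr1n mul1r; apply: ler_sum => x _.
  by rewrite /perm_sum big_seq1 perm1.
under eq_bigr => x _ do rewrite perm_sum_words.
apply: le_trans (hS _ (perm_sum_mean0 _ f0)) _.
rewrite [nu ^+ t.+1]exprS exprMn -[leRHS]mulrA.
by apply: ler_wpM2l; [exact: sqr_ge0 | exact: IH].
Qed.

Lemma norm_bound_form S (nu : R) f : 0 < nu -> norm_bound S nu -> \sum_x f x = 0 ->
  \sum_(s <- S) \sum_x f x * f (s x) <= nu * \sum_x f x ^+ 2.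
Proof.
move=> nu0 hS f0; rewrite exchange_big /=.
under eq_bigr => x _ do rewrite -mulr_sumr -/(perm_sum S f x).
apply: (@le_trans _ _ (\sum_x (nu * f x ^+ 2 + nu^-1 * perm_sum S f x ^+ 2) / 2)).
  apply: ler_sum => x _; move: (f x) (perm_sum S f x) => a b.
  rewrite -subr_ge0; set e := (X in 0 <= X).
  have -> : e = (nu * a - b) ^+ 2 / (2 * nu).
    by rewrite /e; field; rewrite gt_eqF.
  by rewrite divr_ge0 ?sqr_ge0 // mulr_ge0 // ltW.
rewrite -mulr_suml big_split /= -!mulr_sumr.
have := ler_wpM2l (ltW (_ : 0 < nu^-1)) (hS f f0); rewrite invr_gt0 => /(_ nu0).
have -> : nu^-1 * (nu ^+ 2 * \sum_x f x ^+ 2) = nu * \sum_x f x ^+ 2.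
  by field; rewrite gt_eqF.
by lra.
Qed.

End Words.

(** * Expanders of unbounded size with ratio 1/20 *)

Section ExpanderFamily.
Variable R : realFieldType.

Lemma bernoulli (y : R) t : 0 <= y -> 1 + y * t%:R <= (1 + y) ^+ t.
Proof.
move=> y0; elim: t => [|t IH]; first by rewrite mulr0 addr0 expr0.
have y1 : 0 <= 1 + y by lra.
have := ler_wpM2l y1 IH; rewrite -exprS; apply: le_trans.
have : 0 <= y * y * t%:R by rewrite !mulr_ge0.
by rewrite -natr1; lra.
Qed.

(** The ratio of 13 to 257/20 is 1 + 3/257, and 3 * 2000 / 257 > 20, so Bernoulli's inequality
    suffices. *)
Lemma pow_ratio_small t : (2000 <= t)%N -> (257 / 20 : R) ^+ t <= 1 / 20 * 13 ^+ t.
Proof.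
move=> t2000; have t0 : 2000 <= t%:R :> R by rewrite (ler_nat R 2000).
have y0 : 0 <= 3 / 257 :> R by lra.
have := bernoulli t y0.
have -> : (1 + 3 / 257 : R) = 13 * (257 / 20)^-1 by field.
rewrite exprMn exprVn => h.
have c0 : 0 < (257 / 20 : R) ^+ t by rewrite exprn_gt0 //; lra.
have h2 : 20 <= 13 ^+ t / (257 / 20 : R) ^+ t by lra.
by move: h2; rewrite ler_pdivlMr //; lra.
Qed.

(** 13 is 1 modulo 3 and 4, has order 4 modulo 5 and order 2 modulo 7, so 13^4 is 1 modulo 420. *)
Lemma dvdn_13X p j : (0 < p <= 7)%N -> (p %| (13 ^ (4 * j)).-1)%N.
Proof.
move=> p7; apply: (@dvdn_trans 420).
  by case: p p7 => [|[|[|[|[|[|[|[|p]]]]]]]].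
rewrite -subn1 -eqn_mod_dvd ?expn_gt0 // expnM -modnXm.
have -> : (13 ^ 4 %% 420 = 1)%N by [].
by rewrite exp1n.
Qed.

(* 13 is coprime to 420 = lcm(1, ..., 7), so a power of the 13 permutations can be
   chosen with [p] dividing their number minus one. *)
Lemma expander_family p : (0 < p <= 7)%N ->
  exists k : nat, [/\ (0 < k)%N, (p %| k)%N & forall N, exists V : finType,
    (N <= #|V|)%N /\ exists sigma : 'I_k.+1 -> {perm V}, forall f : V -> R,
      \sum_x f x = 0 ->
      \sum_i \sum_x f x * f (sigma i x) <= 1 / 20 * k.+1%:R * \sum_x f x ^+ 2].
Proof.
move=> p7; have [t [t4 t2000]] : exists t, (4 %| t)%N /\ (2000 <= t)%N.
  by exists (4 * 500)%N; split.
have t0 : (0 < t)%N by apply: leq_trans t2000.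
exists (13 ^ t).-1; split.
- by rewrite -ltnS prednK ?expn_gt0 // -[X in (X < _)%N](expn0 13) ltn_exp2l.
- by case/dvdnP: t4 => j ->; rewrite mulnC dvdn_13X.
move=> N; exists ('rV['F_2]_N.+2 * 'rV['F_2]_N.+2)%type; split.
  rewrite card_prod card_mx card_Fp // mul1n -expnD.
  apply: ltnW; apply: leq_trans (ltn_expl N (ltnSn 1)) _.
  by rewrite leq_exp2l //; lia.
have e13 : (13 ^ t).-1.+1 = (13 ^ t)%N by rewrite prednK ?expn_gt0.
rewrite e13; set S := base_perms N.
have sW : size (words S t) = (13 ^ t)%N by rewrite size_words.
have c0 : 0 < 257 / 20 :> R by lra.
exists (fun i => nth 1%g (words S t) i) => f f0.
rewrite -(big_mkord xpredT (fun i => \sum_x f x * f (nth 1%g (words S t) i x))).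
rewrite -sW -(big_nth 1%g xpredT (fun s : {perm _} => \sum_x f x * f (s x))).
have hS : norm_bound S (257 / 20 : R).
  by apply: norm_bound_bilinear => // g h; apply: base_expander.
apply: le_trans (norm_bound_form (exprn_gt0 t c0) (norm_bound_words t hS) f0) _.
rewrite ler_wpM2r ?sumr_ge0 // => [x _|]; first exact: sqr_ge0.
by rewrite sW natrX pow_ratio_small.
Qed.

End ExpanderFamily.

(** * Variational bounds for eigenvalues of real symmetric matrices *)

Section Rayleigh.
Variable R : realType.
Local Notation C := R[i].
Local Notation Re := (@complex.Re R).
Local Notation Im := (@complex.Im R).

Definition quad n (A : 'M[R]_n) (u : 'I_n -> R) : R :=
  \sum_x \sum_y u x * A x y * u y.

Lemma char_poly_conj (F : comNzRingType) n (A P Q : 'M[F]_n) : Q *m P = 1%:M ->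
  char_poly (Q *m A *m P) = char_poly A.
Proof.
move=> QP; rewrite /char_poly /char_poly_mx.
have QP1 : map_mx polyC Q *m map_mx polyC P = 1%:M by rewrite -map_mxM QP map_mx1.
have -> : 'X%:M - map_mx polyC (Q *m A *m P) =
    map_mx polyC Q *m ('X%:M - map_mx polyC A) *m map_mx polyC P.
  by rewrite mulmxBr mulmxBl scalar_mxC -[X in _ = X - _]mulmxA QP1 mulmx1 !map_mxM.
by rewrite !det_mulmx mulrAC -det_mulmx QP1 det1 mul1r.
Qed.

Lemma Re_mulJ (a : R) (z t : C) :
  Re (z * a%:C%C * t^*) = Re z * a * Re t + Im z * a * Im t.
Proof. by case: z => x y; case: t => x' y' /=; ring. Qed.

Lemma Re_herm n (A : 'M[R]_n) (v : 'rV[C]_n) :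
  Re ((v *m map_mx (real_complex R) A *m v^t*)%sesqui 0 0) =
  quad A (fun x => Re (v 0 x)) + quad A (fun x => Im (v 0 x)).
Proof.
rewrite mxE raddf_sum /= /quad.
rewrite [X in _ = X + _]exchange_big [X in _ = _ + X]exchange_big /=.
rewrite -big_split /=; apply: eq_bigr => y _.
rewrite !mxE mulr_suml raddf_sum /= -big_split /=; apply: eq_bigr => x _.
by rewrite !mxE Re_mulJ.
Qed.

(** The diagonalisation is unitary over the complex numbers, so the real forms of the real and
    imaginary parts are added. Permuting the rows of the unitary matrix puts its eigenvalues in the
    order of [s]. *)
Lemma sym_spectral n (A : 'M[R]_n) s : A^T = A -> sorted_spectrum A s ->
  exists P : 'M[C]_n, forall (w : 'rV[C]_n) (v := w *m P)
    (a := fun j => Re (w 0 j) ^+ 2 + Im (w 0 j) ^+ 2),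
  quad A (fun x => Re (v 0 x)) + quad A (fun x => Im (v 0 x)) =
    \sum_(j < n) s`_j * a j /\
  \sum_x Re (v 0 x) ^+ 2 + \sum_x Im (v 0 x) ^+ 2 = \sum_j a j.
Proof.
move=> symA sA; pose f : {rmorphism R -> C} := real_complex R.
pose B : 'M[C]_n := map_mx f A.
have hB : B \is hermsymmx.
  apply: realsym_hermsym.
    by apply/is_hermitianmxP; rewrite expr0 scale1r map_mx_id // map_trmx symA.
  by apply/mxOverP => i j; rewrite mxE; apply/complex_realP; exists (A i j).
have /orthomx_spectralP BE := hermitian_normalmx hB.
pose d j := Re (spectral_diag B 0 j).
have dE j : spectral_diag B 0 j = (d j)%:C%C.
  by have /mxOverP/(_ 0 j)/RRe_real := hermitian_spectral_diag_real hB.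
set U := spectralmx B in BE; set D := spectral_diag B in BE dE.
have Uu : U \is unitarymx := spectral_unitarymx B.
have Ui : U \in unitmx := spectral_unit B.
have sd : perm_eq s [tuple d j | j < n].
  apply: prod_XsubC_eq; rewrite -(proj2 sA) big_map.
  apply: (@map_poly_inj _ _ f); rewrite map_char_poly -/B BE.
  rewrite char_poly_conj ?mulVmx // char_poly_trig ?diag_mx_is_trig // rmorph_prod.
  rewrite big_enum /=; apply: eq_bigr => j _.
  by rewrite mxE eqxx mulr1n dE /= map_polyXsubC.
have [p sp] := tuple_permP sd.
have sE (j : 'I_n) : s`_j = d (p j).
  by rewrite sp -tnth_nth !tnth_mktuple.
exists (row_perm p U) => w v a.
pose w' : 'rV[C]_n := \row_j w 0 (p^-1%g j).
have vE : v = w' *m U.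
  apply/rowP => x; rewrite !mxE [RHS](reindex_inj (@perm_inj _ p)) /=.
  by apply: eq_bigr => j _; rewrite !mxE permK.
have aE : forall j, a j = Re (w' 0 (p j)) ^+ 2 + Im (w' 0 (p j)) ^+ 2.
  by move=> j; rewrite mxE permK.
have vJ : (v^t* = U^t* *m w'^t*)%sesqui by rewrite vE trmx_mul map_mxM.
have UU : (U *m U^t* = 1%:M)%sesqui by apply/unitarymxP.
split.
  have -> : \sum_(j < n) s`_j * a j =
      \sum_(j < n) d j * (Re (w' 0 j) ^+ 2 + Im (w' 0 j) ^+ 2).
    rewrite [RHS](reindex_inj (@perm_inj _ p)) /=.
    by apply: eq_bigr => j _; rewrite sE aE.
  rewrite -Re_herm -/B BE vJ vE invmx_unitary // !mulmxA.
  rewrite -(mulmxA w') UU mulmx1 -!mulmxA (mulmxA U) UU mul1mx mulmxA.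
  rewrite mul_mx_diag mxE raddf_sum /=; apply: eq_bigr => j _.
  by rewrite !mxE dE Re_mulJ; ring.
have -> : \sum_j a j = \sum_j (Re (w' 0 j) ^+ 2 + Im (w' 0 j) ^+ 2).
  by rewrite [RHS](reindex_inj (@perm_inj _ p)); apply: eq_bigr => j _.
have sq (u : 'rV[C]_n) : Re ((u *m u^t*)%sesqui 0 0) =
    \sum_j (Re (u 0 j) ^+ 2 + Im (u 0 j) ^+ 2).
  rewrite mxE raddf_sum /=; apply: eq_bigr => j _; rewrite !mxE.
  by rewrite -[u 0 j]mulr1 (Re_mulJ 1) !mulr1 !expr2.
by rewrite -big_split /= -sq vJ vE -mulmxA (mulmxA U) UU mul1mx sq.
Qed.

Lemma spectrum_le n (A : 'M[R]_n) s c : A^T = A -> sorted_spectrum A s ->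
  (forall u, quad A u <= c * \sum_x u x ^+ 2) ->
  forall i, (i < n)%N -> s`_i <= c.
Proof.
move=> symA sA hc i lt_in; have [P hP] := sym_spectral symA sA.
pose o := Ordinal lt_in; have [] := hP (delta_mx 0 o).
set a := (X in \sum_j _ * X j).
have a0 j : j != o -> a j = 0.
  by rewrite /a mxE eqxx /= => /negPf->; rewrite expr0n addr0.
have a1 : a o = 1 by rewrite /a mxE !eqxx /= expr1n expr0n addr0.
have -> : \sum_(j < n) s`_j * a j = s`_i.
  rewrite (bigD1 o) //= a1 mulr1 big1 ?addr0 // => j jo.
  by rewrite a0 // mulr0.
have -> : \sum_j a j = 1 by rewrite (bigD1 o) //= a1 big1 ?addr0.
move=> <- e; rewrite -[leRHS]mulr1 -e mulrDr.
by apply: lerD; apply: hc.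
Qed.

(** Courant-Fischer: the span of the two lowest eigenvectors contains a nonzero vector orthogonal to
    [phi]. As [phi] is real, the real and imaginary parts of that vector are orthogonal to it
    too. *)
Lemma spectrum2_ge n (A : 'M[R]_n) s l (phi : 'I_n -> R) :
  A^T = A -> sorted_spectrum A s -> (1 < n)%N ->
  (forall u, \sum_x phi x * u x = 0 -> l * \sum_x u x ^+ 2 <= quad A u) ->
  l <= s`_1.
Proof.
move=> symA sA n1 hl; have [P hP] := sym_spectral symA sA.
have s01 : s`_0 <= s`_1.
  apply: (sorted_leq_nth le_trans le_refl 0 (proj1 sA)) => //;
    by rewrite inE (size_sorted_spectrum sA) // ltnW.
have n0 : (0 < n)%N by apply: ltnW.
pose o0 := Ordinal n0; pose o1 := Ordinal n1.
pose ph j : C := \sum_x (phi x)%:C%C * P j x.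
have [al [be [ab0 ab]]] : exists al be : C,
    al * ph o0 + be * ph o1 = 0 /\ (al != 0) || (be != 0).
  have [p0|p0] := eqVneq (ph o0) 0.
    by exists 1, 0; rewrite p0 mulr0 mul0r addr0 oner_neq0.
  by exists (- ph o1), (ph o0); rewrite mulNr mulrC addNr p0 orbT.
pose w : 'rV[C]_n := al *: delta_mx 0 o0 + be *: delta_mx 0 o1.
have w0 : w 0 o0 = al by rewrite !mxE !eqxx mulr1 mulr0 addr0.
have w1 : w 0 o1 = be by rewrite !mxE !eqxx mulr1 mulr0 add0r.
have wj j : j != o0 -> j != o1 -> w 0 j = 0.
  by move=> /negPf j0 /negPf j1; rewrite !mxE j0 j1 !mulr0 addr0.
have wP : \sum_x (phi x)%:C%C * (w *m P) 0 x = 0.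
  rewrite -[RHS]ab0 /ph !mulr_sumr -big_split /=; apply: eq_bigr => x _.
  rewrite mulmxDl -!scalemxAl -!rowE !mxE.
  by ring.
have [] := hP w; set a := (X in \sum_j _ * X j); set v := w *m P => e1 e2.
have hRe : \sum_x phi x * Re (v 0 x) = 0.
  rewrite -[RHS]/(Re 0) -wP raddf_sum; apply: eq_bigr => x _ /=.
  by case: (v 0 x) => *; rewrite /= mul0r subr0.
have hIm : \sum_x phi x * Im (v 0 x) = 0.
  rewrite -[RHS]/(Im 0) -wP raddf_sum; apply: eq_bigr => x _ /=.
  by case: (v 0 x) => *; rewrite /= mul0r addr0.
have := lerD (hl _ hRe) (hl _ hIm); rewrite -mulrDr e1 e2.
have aj j : (j != o0) && (j != o1) -> a j = 0.
  by move=> /andP[j0 j1]; rewrite /a wj // expr0n addr0.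
have -> : \sum_j a j = a o0 + a o1.
  by rewrite (bigD1 o0) //= (bigD1 o1) //= big1 ?addr0.
have -> : \sum_(j < n) s`_j * a j = s`_0 * a o0 + s`_1 * a o1.
  rewrite (bigD1 o0) //= (bigD1 o1) //= big1 ?addr0 // => j jo.
  by rewrite aj // mulr0.
have age j : 0 <= a j by rewrite addr_ge0 ?sqr_ge0.
have apos : 0 < a o0 + a o1.
  rewrite lt_neqAle addr_ge0 // andbT eq_sym paddr_eq0 //.
  rewrite /a w0 w1 !paddr_eq0 ?sqr_ge0 // !sqrf_eq0.
  apply: contraL ab => /andP[/andP[r0 i0] /andP[r1 i1]].
  by rewrite !eq_complex /= r0 i0 r1 i1.
move=> h; rewrite -(ler_pM2r apos); apply: le_trans h _.
by rewrite [leRHS]mulrDr lerD2r ler_wpM2r.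
Qed.

End Rayleigh.

(** * Graphs given by an injective family of edges *)

Section EdgeList.
Variables (n : nat) (J : finType) (s t : J -> 'I_n).
Hypotheses (st : forall j, s j != t j) (inj : injective (fun j => [set s j; t j]%SET)).

Definition edge_adj x y := [exists j, [set s j; t j]%SET == [set x; y]%SET].

Lemma edge_adj_sym : symmetric edge_adj.
Proof. by move=> x y; apply: eq_existsb => j; rewrite [[set x; y]%SET]finset.setUC. Qed.

Lemma edge_adj_irr : irreflexive edge_adj.
Proof.
move=> x; apply/existsP => -[j /eqP e].
have := st j; have := congr1 (fun A : {set _} => s j \in A) e.
have := congr1 (fun A : {set _} => t j \in A) e.
by rewrite !inE !eqxx orbT /= => /esym/orP[]/eqP-> /esym/orP[]/eqP->; rewrite eqxx.
Qed.

Definition edge_graph : sgraph := SGraph edge_adj_sym edge_adj_irr.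

Lemma card_edge_graph : #|edges edge_graph| = #|J|.
Proof.
rewrite -cardsT -(card_imset _ inj); congr #|pred_of_set _|.
apply/finset.setP => e; apply/idP/imsetP => [|[j _ ->]].
  rewrite inE => /existsP[x /existsP[y /andP[/existsP[j /eqP e1] /eqP ->]]].
  by exists j.
rewrite inE; apply/existsP; exists (s j); apply/existsP; exists (t j).
by rewrite eqxx andbT; apply/existsP; exists j.
Qed.

Lemma set2_eq (T : finType) (a b x y : T) : a != b -> ([set a; b]%SET == [set x; y]%SET) =
  ((x == a) && (y == b)) || ((x == b) && (y == a)).
Proof.
move=> ab; apply/eqP/idP => [e|]; last first.
  by case/orP => /andP[/eqP-> /eqP->]; rewrite // finset.setUC.
have := congr1 (fun A : {set _} => a \in A) e.
have := congr1 (fun A : {set _} => b \in A) e; rewrite !inE !eqxx orbT /=.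
case/esym/orP => /eqP eb; case/esym/orP => /eqP ea; rewrite -?ea -?eb ?eqxx ?orbT //.
  by rewrite ea eb eqxx in ab.
by rewrite ea eb eqxx in ab.
Qed.

Variable R : realType.

Lemma edge_adjE x y : (edge_adj x y)%:R =
  \sum_j (((x == s j) && (y == t j))%:R + ((x == t j) && (y == s j))%:R) :> R.
Proof.
have [/existsP[j /eqP ej]|/existsPn nj] := boolP (edge_adj x y); last first.
  rewrite big1 // => j _; have := nj j; rewrite set2_eq // negb_or.
  by move=> /andP[/negPf-> /negPf->]; rewrite addr0.
rewrite (bigD1 j) //= big1 ?addr0 => [|i ij].
  have := eqxx [set x; y]%SET; rewrite -{1}ej set2_eq //.
  have [->|xs] := eqVneq x (s j); first by rewrite (negPf (st j)) /= orbF addr0 => ->.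
  by rewrite /= add0r => ->.
have : [set s i; t i]%SET != [set x; y]%SET.
  by apply: contra ij => /eqP; rewrite -ej => /inj->.
by rewrite set2_eq // negb_or => /andP[/negPf-> /negPf->]; rewrite addr0.
Qed.

Lemma edge_sum (F : 'I_n -> 'I_n -> R) :
  \sum_x \sum_y (edge_adj x y)%:R * F x y = \sum_j (F (s j) (t j) + F (t j) (s j)).
Proof.
have pick a b : \sum_x \sum_y ((x == a) && (y == b))%:R * F x y = F a b.
  rewrite (bigD1 a) //= [X in _ + X]big1 ?addr0 => [|x /negPf xa]; last first.
    by rewrite big1 // => y _; rewrite xa mul0r.
  rewrite (bigD1 b) //= [X in _ + X]big1 ?addr0 => [|y /negPf yb]; last first.
    by rewrite yb andbF mul0r.
  by rewrite !eqxx mul1r.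
rewrite (eq_bigr (fun x => \sum_j \sum_y (((x == s j) && (y == t j))%:R * F x y
    + ((x == t j) && (y == s j))%:R * F x y))) => [|x _].
  rewrite exchange_big /=; apply: eq_bigr => j _.
  under eq_bigr => x _ do rewrite big_split /=.
  by rewrite big_split /= !pick.
rewrite exchange_big; apply: eq_bigr => y _ /=.
by rewrite edge_adjE mulr_suml; apply: eq_bigr => j _; rewrite mulrDl.
Qed.

Lemma quad_laplacian (u : 'I_n -> R) :
  quad (laplacian R edge_graph) u = \sum_j (u (s j) - u (t j)) ^+ 2.
Proof.
transitivity (\sum_x \sum_y (edge_adj x y)%:R * (u x ^+ 2 - u x * u y)).
  apply: eq_bigr => x _.
  under eq_bigr => y _ do rewrite !mxE mulrBr mulrBl.
  under [RHS]eq_bigr => y _ do rewrite mulrBr.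
  rewrite !big_split /=; congr (_ + _); last first.
    by apply: eq_bigr => y _; ring.
  rewrite (bigD1 x) //= big1 ?addr0 => [|y /negPf yx]; last first.
    by rewrite eq_sym yx mulr0n mulr0 mul0r.
  rewrite eqxx mulr1n /degree -sum1_card natr_sum -mulr_suml big_mkcond /=.
  rewrite -mulrA mulrC -mulrA -expr2; congr (_ * _).
  by apply: eq_bigr => y _; rewrite inE; case: ifP.
by rewrite edge_sum; apply: eq_bigr => j _; ring.
Qed.

End EdgeList.

(** * From energy inequalities to a connected graph with large eigenvalue ratio *)

Section SpectralRatio.
Variables (R : realType) (X J : finType) (s t : J -> X).

Lemma graph_of_edges (l c : R) (phi : X -> R) :
  (forall j, s j != t j) -> injective (fun j => [set s j; t j]%SET) ->
  (1 < #|X|)%N -> 0 < l ->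
  (forall f : X -> R, \sum_j (f (s j) - f (t j)) ^+ 2 <= c * \sum_x f x ^+ 2) ->
  (forall f : X -> R, \sum_x phi x * f x = 0 ->
     l * \sum_x f x ^+ 2 <= \sum_j (f (s j) - f (t j)) ^+ 2) ->
  exists G, [/\ nverts G = #|X|, #|edges G| = #|J|, connected_graph G &
     l / c <= lambda R G 2 / lambda R G (nverts G)].
Proof.
move=> st inj X1 l0 hc hl.
pose s' j := enum_rank (s j); pose t' j := enum_rank (t j).
have st' j : s' j != t' j by rewrite (inj_eq enum_rank_inj).
have inj' : injective (fun j => [set s' j; t' j]%SET).
  move=> i j e; apply: inj; apply: (imset_inj enum_rank_inj).
  by rewrite !imsetU1 !imset_set1.
pose G := edge_graph st'; exists G.
have reX (F : 'I_#|X| -> R) : \sum_i F i = \sum_x F (enum_rank x).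
  by rewrite (reindex _ (onW_bij _ (@enum_rank_bij X))).
have hc' u : quad (laplacian R G) u <= c * \sum_i u i ^+ 2.
  by rewrite quad_laplacian // reX; apply: (hc (u \o enum_rank)).
pose phi' (i : 'I_#|X|) := phi (enum_val i).
have hl' u : \sum_i phi' i * u i = 0 -> l * \sum_i u i ^+ 2 <= quad (laplacian R G) u.
  rewrite quad_laplacian // !reX => h; apply: (hl (u \o enum_rank)).
  by rewrite -[RHS]h; apply: eq_bigr => x _; rewrite /phi' enum_rankK.
have sL := laplacian_sym R G; have sE := laplacian_eigenvaluesP R G.
have l2 : l <= lambda R G 2 by apply: (spectrum2_ge sL sE X1 hl').
have n1 : (#|X|.-1 < #|X|)%N by rewrite prednK // ltnW.
have ln : lambda R G (nverts G) <= c by apply: (spectrum_le sL sE hc' n1).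
have l2n : lambda R G 2 <= lambda R G (nverts G).
  rewrite /lambda; apply: (sorted_leq_nth le_trans le_refl 0 (proj1 sE));
    by rewrite ?inE ?(size_sorted_spectrum sE) //= -ltnS prednK // ltnW.
split => //; first exact: card_edge_graph.
  split; first exact: ltnW.
  move=> x y; apply: contraT => nxy.
  (* If [y] is not reached from [x], some nonzero function, constant on the component of [x] and on
     its complement, satisfies the linear constraint. Its energy is 0, against [l0]. *)
  pose a := \sum_(i | connect (@adj G) x i) phi' i.
  pose b := \sum_(i | ~~ connect (@adj G) x i) phi' i.
  have [al [be [ab0 ab]]] : exists al be : R, al * a + be * b = 0 /\
      (al != 0) || (be != 0).
    have [p0|p0] := eqVneq a 0.
      by exists 1, 0; rewrite p0 mulr0 mul0r addr0 oner_neq0.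
    by exists (- b), a; rewrite mulNr mulrC addNr p0 orbT.
  pose u i := if connect (@adj G) x i then al else be.
  have u0 : \sum_i phi' i * u i = 0.
    rewrite -[RHS]ab0 /a /b (bigID (connect (@adj G) x)) /= !mulr_sumr.
    by congr (_ + _); apply: eq_bigr => i ci; rewrite mulrC /u ?ci ?(negPf ci).
  have := hl' u u0; rewrite quad_laplacian // [X in _ <= X]big1 => [|j _]; last first.
    have ad : adj (s := G) (s' j) (t' j) by apply/existsP; exists j.
    have cs : connect_sym (@adj G).
      by apply: sym_connect_sym; apply: adj_sym.
    by rewrite /u (same_connect1r cs ad) subrr expr0n.
  rewrite pmulr_rle0 // => su.
  have z i : u i = 0.
    have /eqP : \sum_i u i ^+ 2 == 0.
      by rewrite eq_le su sumr_ge0 // => ? _; apply: sqr_ge0.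
    move=> /psumr_eq0P => /(_ (fun i _ => sqr_ge0 _) i isT)/eqP.
    by rewrite sqrf_eq0 => /eqP.
  have := z x; have := z y; rewrite /u connect0 (negPf nxy) => b0 a0.
  by rewrite a0 b0 eqxx in ab.
have l20 : 0 < lambda R G 2 by apply: lt_le_trans l2.
have ln0 := lt_le_trans l20 l2n; have c0 := lt_le_trans ln0 ln.
apply: ler_pM => //; first exact: ltW.
  by rewrite invr_ge0 ltW.
by rewrite lef_pV2 ?posrE.
Qed.

End SpectralRatio.

(** * Two inequalities for sums *)

Section Sums.
Variable R : realFieldType.

Lemma sum_inj_le (A B : finType) (h : A -> B) (F : B -> R) :
  injective h -> (forall x, 0 <= F x) -> \sum_a F (h a) <= \sum_x F x.
Proof.
move=> hI F0; have -> : \sum_a F (h a) = \sum_(x in h @: A) F x.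
  by rewrite big_imset //= => a a' _ _; apply: hI.
rewrite [leRHS](bigID (mem (h @: A))) /= lerDl.
by apply: sumr_ge0.
Qed.

Lemma telescope_sqr_le (a : nat -> R) m :
  (a m - a 0%N) ^+ 2 <= m%:R * \sum_(0 <= i < m) (a i.+1 - a i) ^+ 2.
Proof.
elim: m => [|m IH]; first by rewrite subrr expr0n mul0r.
have [->|m0] := posnP m; first by rewrite big_nat1 mul1r.
rewrite big_nat_recr //=; set E := \sum_(0 <= i < m) _ in IH *.
have E0 : 0 <= E by apply: sumr_ge0 => i _; apply: sqr_ge0.
set d := a m.+1 - a m; set A := a m - a 0%N in IH.
have -> : a m.+1 - a 0%N = A + d by rewrite /A /d; ring.
have mR : 0 < m%:R :> R by rewrite ltr0n.
have h : 2 * A * d <= E + m%:R * d ^+ 2.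
  apply: (@le_trans _ _ (A ^+ 2 / m%:R + m%:R * d ^+ 2)); last first.
    by rewrite lerD2r ler_pdivrMr // mulrC.
  rewrite -subr_ge0; set e := (X in 0 <= X).
  have -> : e = (A - m%:R * d) ^+ 2 / m%:R.
    by rewrite /e; field; rewrite gt_eqF.
  by rewrite divr_ge0 ?sqr_ge0 // ltW.
by rewrite -natr1; lra.
Qed.

End Sums.

(** * The graph: gadgets joined by long paths, and its energy *)

Section Construction.
Variables (V : finType) (k' : nat) (sigma : 'I_k'.+1 -> {perm V}) (b : 'I_k'.+1 -> nat).
Notation k := k'.+1.
Hypothesis b2 : forall i, (2 <= b i)%N.

(** Index 0 on path [i] is the [i]-th gadget vertex itself; indices 1 to [b i] are the interior
    vertices of the path leaving it. *)
Definition pos := {i : 'I_k & 'I_(b i).+1}.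
Definition vert : finType := (V * pos)%type.

Definition at_ (v : V) (i : 'I_k) (j : nat) : vert :=
  (v, Tagged (fun i => 'I_(b i).+1) (inord j : 'I_(b i).+1)).

Definition vpath (x : vert) : 'I_k := tag x.2.
Definition vidx (x : vert) : nat := tagged x.2.

Lemma at_K x : at_ x.1 (vpath x) (vidx x) = x.
Proof.
case: x => v [i j]; rewrite /at_ /vidx /vpath /=; congr (_, Tagged _ _).
exact: inord_val.
Qed.

Lemma vidx_le x : (vidx x <= b (vpath x))%N.
Proof. by rewrite -ltnS; apply: ltn_ord. Qed.

Lemma vidx_at v i j : (j <= b i)%N -> vidx (at_ v i j) = j.
Proof. by move=> ji; rewrite /vidx /= inordK. Qed.

(** The last interior vertex is followed by the [i]-th gadget vertex of the image under [sigma i].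
    The path edges are thus the pairs of [x] and [next x], with [(b i).+1] edges on each path. *)
Definition next (x : vert) : vert :=
  if (vidx x < b (vpath x))%N then at_ x.1 (vpath x) (vidx x).+1
  else at_ (sigma (vpath x) x.1) (vpath x) 0.

Lemma vpath_next x : vpath (next x) = vpath x.
Proof. by rewrite /next; case: ifP. Qed.

Lemma vidx_next x :
  vidx (next x) = if (vidx x < b (vpath x))%N then (vidx x).+1 else 0%N.
Proof. by rewrite /next; case: ifP => h; rewrite vidx_at. Qed.

Lemma next_inj : injective next.
Proof.
move=> x y e; have ep : vpath x = vpath y by rewrite -vpath_next e vpath_next.
have := congr1 vidx e; rewrite !vidx_next => ei.
have exy : vidx x = vidx y /\ x.1 = y.1.
  have := congr1 fst e; rewrite /next -ep in ei *.
  have := vidx_le x; have := vidx_le y; rewrite -ep.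
  move: ei; case: ltnP => hx; case: ltnP => hy //= ei lx ly ef.
    by split=> //; case: ei.
  split; first by apply/eqP; rewrite eqn_leq (leq_trans lx hx) (leq_trans ly hy).
  by apply: perm_inj ef.
by rewrite -[x]at_K -[y]at_K ep; case: exy => -> ->.
Qed.

Lemma next_neq x : x != next x.
Proof.
apply/eqP => e; have := congr1 vidx e; rewrite vidx_next.
case: ltnP => [_ /eqP|h h0]; first by rewrite ltn_eqF.
by move: h; rewrite h0 leqNgt (leq_trans _ (b2 _)).
Qed.

(** By [b2] the orbits of [next] have length at least 3, even at fixed points of [sigma], so no path
    edge is doubled. *)
Lemma next2_neq x : x != next (next x).
Proof.
apply/eqP => e; have := congr1 vidx e; rewrite !vidx_next vpath_next.
have := b2 (vpath x).
move: (vidx x) (b _) => i m m2 ei.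
have : (i < m)%N \/ (m <= i)%N by lia.
case=> im; move: ei; rewrite ?im ?ltnNge ?im /=; case: ifP => h; lia.
Qed.

Definition edge_type : finType := (vert + V * 'I_k')%type.

Definition src (e : edge_type) : vert :=
  match e with inl x => x | inr (v, i) => at_ v (inord i) 0 end.

Definition tgt (e : edge_type) : vert :=
  match e with inl x => next x | inr (v, i) => at_ v (inord i.+1) 0 end.

Lemma inord_neq (i : 'I_k') : (inord i : 'I_k) != inord i.+1.
Proof.
have := ltn_ord i => ik; have ik' := ltnW ik.
by rewrite -val_eqE /= !inordK ?ltnS // neq_ltn ltnSn.
Qed.

Lemma src_tgt e : src e != tgt e.
Proof.
case: e => [x|[v i]]; first exact: next_neq.
by apply/eqP => /(congr1 vpath) /=; apply/eqP/inord_neq.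
Qed.

(** Path edges keep the path index and gadget edges change it, so the two kinds never coincide;
    [next2_neq] excludes a path edge traversed backwards. *)
Lemma edge_inj : injective (fun e => [set src e; tgt e]%SET).
Proof.
move=> e e' /eqP; rewrite set2_eq ?src_tgt //.
case: e => [x|[v i]]; case: e' => [y|[w j]] /=.
- case/orP => /andP[/eqP h1 /eqP h2]; first by rewrite h1.
  by have := next2_neq x; rewrite -h1 h2 eqxx.
- case/orP => /andP[/eqP h1 /eqP h2].
    have := inord_neq j; rewrite -[inord j]/(vpath (at_ w (inord j) 0)) h1.
    by rewrite -[inord _.+1]/(vpath (at_ w (inord j.+1) 0)) h2 vpath_next eqxx.
  have := inord_neq j; rewrite -[inord j]/(vpath (at_ w (inord j) 0)) h1.
  by rewrite -[inord _.+1]/(vpath (at_ w (inord j.+1) 0)) h2 vpath_next eqxx.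
- case/orP => /andP[/eqP h1 /eqP h2].
    have := inord_neq i; rewrite -[inord i]/(vpath (at_ v (inord i) 0)) -h1.
    by rewrite -[inord _.+1]/(vpath (at_ v (inord i.+1) 0)) -h2 vpath_next eqxx.
  have := inord_neq i; rewrite -[inord i]/(vpath (at_ v (inord i) 0)) -h2.
  by rewrite -[inord _.+1]/(vpath (at_ v (inord i.+1) 0)) -h1 vpath_next eqxx.
have val1 (u : 'I_k') : nat_of_ord (inord u : 'I_k) = u.
  by rewrite inordK // ltnS (ltnW (ltn_ord u)).
have val2 (u : 'I_k') : nat_of_ord (inord u.+1 : 'I_k) = u.+1.
  by rewrite inordK // ltnS ltn_ord.
case/orP => /andP[/eqP h1 /eqP h2].
  have := congr1 (fun x => nat_of_ord (vpath x)) h1; have := congr1 fst h1.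
  by rewrite /= !val1 => -> /val_inj ->.
have := congr1 (fun x => nat_of_ord (vpath x)) h1.
have := congr1 (fun x => nat_of_ord (vpath x)) h2.
by rewrite /= !val1 !val2; lia.
Qed.

Lemma card_vert : #|vert| = (#|V| * \sum_i (b i).+1)%N.
Proof.
rewrite card_prod card_tagged sumnE big_map big_enum; congr (_ * _)%N.
by apply: eq_bigr => i _; exact: card_ord.
Qed.

Lemma card_edge_type : #|edge_type| = (#|vert| + #|V| * k')%N.
Proof. by rewrite card_sum [X in (_ + X)%N]card_prod card_ord. Qed.

Variable R : realType.
Implicit Types f : vert -> R.

Lemma sum_vert f :
  \sum_x f x = \sum_v \sum_i \sum_(0 <= j < (b i).+1) f (at_ v i j).
Proof.
transitivity (\sum_v \sum_(p : pos) f (v, p)).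
  by rewrite pair_bigA; apply: eq_bigr => -[v p] _.
apply: eq_bigr => v _; transitivity (\sum_(i < k) \sum_(j < (b i).+1)
  f (v, Tagged (fun i => 'I_(b i).+1) j)).
  rewrite (@sig_big_dep R 0 _ _ (fun i : 'I_k => 'I_(b i).+1) xpredT
    (fun=> xpredT) (fun i j => f (v, Tagged (fun i => 'I_(b i).+1) j))) /=.
  by apply: eq_bigr => -[i j] _.
apply: eq_bigr => i _; rewrite big_mkord; apply: eq_bigr => j _.
by rewrite /at_ inord_val.
Qed.

Definition energy f : R := \sum_e (f (src e) - f (tgt e)) ^+ 2.

Lemma energyE f : energy f = \sum_x (f x - f (next x)) ^+ 2
  + \sum_v \sum_(0 <= i < k') (f (at_ v (inord i.+1) 0) - f (at_ v (inord i) 0)) ^+ 2.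
Proof.
rewrite /energy big_sumType /=; congr (_ + _).
transitivity (\sum_v \sum_(i < k')
  (f (src (inr (v, i))) - f (tgt (inr (v, i)))) ^+ 2).
  by rewrite pair_bigA; apply: eq_bigr => -[v i] _.
apply: eq_bigr => v _; rewrite big_mkord; apply: eq_bigr => i _.
by rewrite -sqrrN opprB.
Qed.

(** Each vertex is the source of at most one path edge and one gadget edge, and likewise the target;
    with (x - y)^2 <= 2 x^2 + 2 y^2 this gives 2 * (2 + 2). *)
Lemma energy_le f : energy f <= 8 * \sum_x f x ^+ 2.
Proof.
have sqB (x y : R) : (x - y) ^+ 2 <= 2 * x ^+ 2 + 2 * y ^+ 2.
  by have := sqr_ge0 (x + y); lra.
apply: (@le_trans _ _ (\sum_e (2 * f (src e) ^+ 2 + 2 * f (tgt e) ^+ 2))).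
  by apply: ler_sum => e _.
rewrite big_split /= -!mulr_sumr.
have f0 x : 0 <= f x ^+ 2 by apply: sqr_ge0.
have hs : \sum_e f (src e) ^+ 2 <= 2 * \sum_x f x ^+ 2.
  rewrite big_sumType /=; have := @sum_inj_le R _ _
    (fun p : V * 'I_k' => at_ p.1 (inord p.2) 0) (fun x => f x ^+ 2) _ f0.
  have hI : injective (fun p : V * 'I_k' => at_ p.1 (inord p.2) 0).
    move=> [v i] [w j] e; have := congr1 fst e => /= ->.
    have := congr1 (fun x => nat_of_ord (vpath x)) e.
    by rewrite /= !inordK ?ltnS ?(ltnW (ltn_ord _)) // => /val_inj ->.
  move=> /(_ hI); have -> : \sum_(i in {: V * 'I_k'})
      f (let (v, i0) := i in at_ v (inord i0) 0) ^+ 2 =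
      \sum_(p : V * 'I_k') f (at_ p.1 (inord p.2) 0) ^+ 2.
    by apply: eq_bigr => -[].
  by lra.
have ht : \sum_e f (tgt e) ^+ 2 <= 2 * \sum_x f x ^+ 2.
  rewrite big_sumType /=; have := @sum_inj_le R _ _
    (fun p : V * 'I_k' => at_ p.1 (inord p.2.+1) 0) (fun x => f x ^+ 2) _ f0.
  have hI : injective (fun p : V * 'I_k' => at_ p.1 (inord p.2.+1) 0).
    move=> [v i] [w j] e; have := congr1 fst e => /= ->.
    have := congr1 (fun x => nat_of_ord (vpath x)) e.
    by rewrite /= !inordK ?ltnS ?ltn_ord // => -[] /val_inj ->.
  move=> /(_ hI); have -> : \sum_(i in {: V * 'I_k'})
      f (let (v, i0) := i in at_ v (inord i0.+1) 0) ^+ 2 =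
      \sum_(p : V * 'I_k') f (at_ p.1 (inord p.2.+1) 0) ^+ 2.
    by apply: eq_bigr => -[].
  have -> : \sum_x f (next x) ^+ 2 = \sum_x f x ^+ 2.
    by rewrite [RHS](reindex_inj next_inj).
  by lra.
by lra.
Qed.

Section Gadget.
Variable h : V -> 'I_k -> R.

Definition deviation := \sum_v \sum_i (h v i - h v ord0) ^+ 2.
Definition gadget_energy :=
  \sum_v \sum_(0 <= i < k') (h v (inord i.+1) - h v (inord i)) ^+ 2.

(** One factor [k] comes from Cauchy-Schwarz along the gadget, the other from the number of its
    vertices. *)
Lemma deviation_le : deviation <= k%:R ^+ 2 * gadget_energy.
Proof.
rewrite /gadget_energy mulr_sumr; apply: ler_sum => v _.
set E := \sum_(0 <= i < k') _.
have -> : k%:R ^+ 2 * E = \sum_(i < k) k%:R * E.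
  by rewrite sumr_const card_ord expr2 -mulrA mulr_natl.
apply: ler_sum => i _.
have := telescope_sqr_le (fun j => h v (inord j)) i; rewrite /= inord_val.
have -> : inord 0 = ord0 :> 'I_k by apply: ord_inj; rewrite inordK.
move=> /le_trans; apply; apply: ler_pM => //.
- by apply: sumr_ge0 => j _; apply: sqr_ge0.
- by rewrite ler_nat ltnW.
rewrite /E [leRHS](big_cat_nat (n := i)) //=; last by rewrite -ltnS.
by rewrite lerDl; apply: sumr_ge0 => j _; apply: sqr_ge0.
Qed.

(** The values are split into a part constant on gadgets, of mass [G] and controlled by the
    expander, and deviations [Y], controlled by the gadget energy. *)
Lemma expander_estimate (D S l : R) :
  (forall g : V -> R, \sum_v g v = 0 ->
    \sum_i \sum_v g v * g (sigma i v) <= 1 / 20 * k%:R * \sum_v g v ^+ 2) ->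
  \sum_v h v ord0 = 0 ->
  1 / 8 <= D -> 0 < S -> 0 <= l -> l * S <= 1 / 20 ->
  115 / S + 2 * l <= (k%:R ^+ 2)^-1 ->
  0 <= \sum_v \sum_i (D * (h v i ^+ 2 + h (sigma i v) i ^+ 2)
         - 2 * h v i * h (sigma i v) i) / S
       - l * \sum_v \sum_i h v i ^+ 2 + gadget_energy.
Proof.
move=> hsig h0 D8 S0 l0 lS kS.
have swap (F : V -> 'I_k -> R) :
    \sum_v \sum_i F (sigma i v) i = \sum_v \sum_i F v i.
  rewrite exchange_big [RHS]exchange_big /=; apply: eq_bigr => i _.
  by rewrite [RHS](reindex_inj (@perm_inj _ (sigma i))).
set G := k%:R * \sum_v h v ord0 ^+ 2.
have GE : \sum_v \sum_(i < k) h v ord0 ^+ 2 = G.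
  by rewrite /G mulr_sumr; apply: eq_bigr => v _; rewrite sumr_const card_ord mulr_natl.
set H := \sum_v \sum_i h v i ^+ 2; set Y := deviation.
set W := \sum_v \sum_i h v i * h (sigma i v) i.
(* Mixed products are split as a b <= a^2 / 100 + 25 b^2, and the product of two deviations adds 1/2
   to the 25: the coefficients become 1/20 + 2/100 and 2 * 51/2. *)
have W_le : W <= 7 / 100 * G + 51 * Y.
  have hs := hsig _ h0.
  apply: (@le_trans _ _ (\sum_v \sum_i (h v ord0 * h (sigma i v) ord0
     + (h v ord0 ^+ 2 / 100 + h (sigma i v) ord0 ^+ 2 / 100
     + (51 / 2 * (h v i - h v ord0) ^+ 2
       + 51 / 2 * (h (sigma i v) i - h (sigma i v) ord0) ^+ 2))))).
    apply: ler_sum => v _; apply: ler_sum => i _.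
    move: (h v i) (h (sigma i v) i) (h v ord0) (h (sigma i v) ord0) => x x' g g'.
    have := sqr_ge0 (g - 50 * (x' - g')); have := sqr_ge0 (g' - 50 * (x - g)).
    by have := sqr_ge0 ((x - g) - (x' - g')); lra.
  under eq_bigr => v _ do rewrite !big_split /=.
  rewrite !big_split /= (swap (fun v _ => h v ord0 ^+ 2 / 100)).
  rewrite (swap (fun v i => 51 / 2 * (h v i - h v ord0) ^+ 2)).
  have -> : \sum_v \sum_(i < k) h v ord0 ^+ 2 / 100 = G / 100.
    by rewrite -GE mulr_suml; apply: eq_bigr => v _; rewrite mulr_suml.
  have -> : \sum_v \sum_i 51 / 2 * (h v i - h v ord0) ^+ 2 = 51 / 2 * Y.
    by rewrite /Y mulr_sumr; apply: eq_bigr => v _; rewrite mulr_sumr.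
  rewrite exchange_big /=; move: hs; rewrite -[1 / 20 * _ * _]mulrA -/G.
  by move: (\sum_(j < k) _) => T; lra.
have H_ge : 98 / 100 * G - 50 * Y <= H.
  rewrite -GE /Y /deviation !mulr_sumr -sumrB; apply: ler_sum => v _.
  rewrite !mulr_sumr -sumrB; apply: ler_sum => i _.
  have := sqr_ge0 (h v i - h v ord0).
  by have := sqr_ge0 (h v ord0 + 50 * (h v i - h v ord0)); lra.
have H_le : H <= 2 * G + 2 * Y.
  rewrite -GE /Y /deviation !mulr_sumr -big_split; apply: ler_sum => v _ /=.
  rewrite !mulr_sumr -big_split; apply: ler_sum => i _ /=.
  by have := sqr_ge0 (h v i - 2 * h v ord0); lra.
have G0 : 0 <= G by rewrite mulr_ge0 // sumr_ge0 // => v _; apply: sqr_ge0.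
have Y0 : 0 <= Y by do 2 (apply: sumr_ge0 => ? _); apply: sqr_ge0.
have H0 : 0 <= H by do 2 (apply: sumr_ge0 => ? _); apply: sqr_ge0.
have -> : \sum_v \sum_i (D * (h v i ^+ 2 + h (sigma i v) i ^+ 2)
         - 2 * h v i * h (sigma i v) i) / S = (2 * D * H - 2 * W) / S.
  transitivity (\sum_v \sum_i (D / S * h v i ^+ 2 + D / S * h (sigma i v) i ^+ 2
     + (- (2 / S)) * (h v i * h (sigma i v) i))).
    by apply: eq_bigr => v _; apply: eq_bigr => i _; ring.
  under eq_bigr => v _ do rewrite !big_split /=.
  rewrite !big_split /= (swap (fun v i => D / S * h v i ^+ 2)).
  under eq_bigr => v _ do rewrite -mulr_sumr.
  under [X in _ + X]eq_bigr => v _ do rewrite -mulr_sumr.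
  by rewrite -!mulr_sumr -/H -/W; ring.
(* With 2 D >= 1/4: 98/400 - 14/100 = 105/1000, and 50/4 + 102 <= 115. *)
have p1 : (105 / 1000 * G - 115 * Y) / S <= (2 * D * H - 2 * W) / S.
  rewrite ler_pM2r ?invr_gt0 //.
  have : 1 / 8 * H <= D * H by rewrite ler_wpM2r.
  by lra.
have p2 : l * H <= 2 * l * G + 2 * l * Y.
  by have := ler_wpM2l l0 H_le; lra.
have p3 : 2 * l * G <= 105 / 1000 * G / S.
  by rewrite [leRHS]mulrAC ler_wpM2r // ler_pdivlMr //; lra.
have k0 : 0 < k%:R ^+ 2 :> R by rewrite exprn_gt0 ?ltr0n.
have p4 : (115 / S + 2 * l) * Y <= gadget_energy.
  apply: (@le_trans _ _ ((k%:R ^+ 2)^-1 * Y)); first by rewrite ler_wpM2r.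
  by rewrite mulrC ler_pdivrMr // mulrC deviation_le.
by lra.
Qed.

End Gadget.

(** All paths are compared with the common length [L], which gives the same coefficients [chebD l L]
    and [chebS l L] for each, and the expander bound applies to the sum. *)
Lemma energy_ge f (L : nat) (l : R) :
  (forall g : V -> R, \sum_v g v = 0 ->
    \sum_i \sum_v g v * g (sigma i v) <= 1 / 20 * k%:R * \sum_v g v ^+ 2) ->
  (forall i, (b i < L)%N) -> (1000 * k ^ 2 <= L)%N ->
  0 <= l -> l * L%:R ^+ 2 <= 2 ->
  \sum_v f (at_ v ord0 0) = 0 -> l * \sum_x f x ^+ 2 <= energy f.
Proof.
move=> hsig bL kL l0 lL f0.
have k1 : (1 <= k ^ 2)%N by rewrite expn_gt0.
have L1000 : (1000 <= L)%N by apply: leq_trans kL; rewrite leq_pmulr.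
have L100 : (100 <= L)%N by apply: leq_trans L1000.
have /andP[S_ge S_le] := chebS_bounds l0 lL L100 (leqnn L).
have L0 : 0 < L%:R :> R by rewrite ltr0n (leq_trans _ L100).
have S0 : 0 < chebS l L by apply: lt_le_trans S_ge; rewrite divr_gt0.
have Sj j : (j <= L.-1)%N -> 0 < chebS l j.+1.
  move=> jL; have jL' : (j.+1 <= L)%N by rewrite -(prednK (n := L)) ?(leq_trans _ L100).
  have /andP[+ _] := chebS_bounds l0 lL L100 jL'.
  by apply: lt_le_trans; rewrite divr_gt0.
have LK : L.-1.+1 = L by rewrite prednK // (leq_trans _ L100).
pose h v i := f (at_ v i 0).
have path_bound v i :
  (chebD l L * (h v i ^+ 2 + h (sigma i v) i ^+ 2) - 2 * h v i * h (sigma i v) i)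
    / chebS l L <=
  \sum_(0 <= j < (b i).+1) (f (at_ v i j) - f (next (at_ v i j))) ^+ 2
  - l * \sum_(1 <= j < (b i).+1) f (at_ v i j) ^+ 2.
  (* The index [(b i).+1] is out of range for [at_]; there [p] takes the value at the far end of the
     path. *)
  pose p j := if (j <= b i)%N then f (at_ v i j) else h (sigma i v) i.
  have := @path_form_pad R l p L.-1 (b i) l0 _ Sj.
  rewrite LK {1 2 3 4}/p ltnn leq0n => hp.
  have bL' : (b i <= L.-1)%N by rewrite -ltnS LK.
  apply: le_trans (hp bL') _; rewrite le_eqVlt; apply/orP; left; apply/eqP.
  congr (_ - l * _); rewrite big_nat [RHS]big_nat; apply: eq_bigr => j /andP[j0 ji].
    rewrite ltnS in ji; rewrite -sqrrN opprB /p ji; congr ((_ - _) ^+ 2).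
    by rewrite /next /vpath vidx_at //=; case: ifP.
  by rewrite /p -ltnS ji.
rewrite -subr_ge0 energyE.
have := @expander_estimate h (chebD l L) (chebS l L) l hsig f0
  (chebD_ge l0 lL L100) S0 l0.
have lS : l * chebS l L <= 1 / 20.
  apply: (@le_trans _ _ (l * L%:R)); first by rewrite ler_wpM2l.
  rewrite -(ler_pM2r L0) -mulrA -expr2; apply: le_trans lL _.
  have : 1000 <= L%:R :> R by rewrite (ler_nat R 1000).
  by lra.
(* Since [chebS l L] is at least L/8 and l L^2 <= 2, the left side is at most (920 + 4) / L. *)
have kS : 115 / chebS l L + 2 * l <= (k%:R ^+ 2)^-1.
  apply: (@le_trans _ _ (1000 / L%:R)); last first.
    rewrite ler_pdivrMr // mulrC ler_pdivlMr ?exprn_gt0 ?ltr0n //.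
    by rewrite -natrX -natrM ler_nat.
  have : 115 / chebS l L <= 920 / L%:R.
    by rewrite ler_pdivrMr // mulrAC ler_pdivlMr //; lra.
  have : 2 * l <= 4 / L%:R.
    rewrite ler_pdivlMr //; have : l * L%:R <= l * L%:R ^+ 2; last by lra.
    by rewrite ler_wpM2l // ler_eXnr // ler1n (leq_trans _ L100).
  have i0 : 0 < L%:R^-1 :> R by rewrite invr_gt0.
  by lra.
move=> /(_ lS kS) /le_trans; apply.
rewrite [leRHS]addrAC; apply: lerD; last exact: lexx.
rewrite !sum_vert.
rewrite !mulr_sumr -!sumrB; apply: ler_sum => v _.
rewrite !mulr_sumr -!sumrB; apply: ler_sum => i _.
(* The term of index 0 is the gadget vertex, whose mass is already in the expander estimate; the
   others are interior mass. *)
have := path_bound v i; rewrite [X in _ -> _ <= _ - l * X]big_ltn //.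
by rewrite -/(h v i); lra.
Qed.

End Construction.

(** * The bound to beat *)

Lemma ramanujan_ratio_lt (R : realType) (delta d : R) :
  0 < delta -> d = 2 + delta ->
  (d - 2 * Num.sqrt (d - 1)) / (d + 2 * Num.sqrt (d - 1)) < delta ^+ 2 / 16.
Proof.
move=> d0 ed; set r := Num.sqrt (d - 1).
have rr : r ^+ 2 = 1 + delta by rewrite sqr_sqrtr ed; lra.
have r0 : 0 <= r by apply: sqrtr_ge0.
have r1 : 1 < r by rewrite -(ltr_pXn2r (n := 2)) ?nnegrE // expr1n rr; lra.
have dE : delta = r ^+ 2 - 1 by rewrite rr; ring.
(* The ratio becomes ((r - 1) / (r + 1))^2 = delta^2 / (r + 1)^4, and r + 1 > 2. *)
have -> : d = r ^+ 2 + 1 by rewrite ed rr; ring.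
rewrite ltr_pdivrMr; last by nra.
rewrite dE -subr_gt0; set e := (X in 0 < X).
have -> : e = (r - 1) ^+ 2 * ((r + 1) ^+ 4 - 16) / 16 by rewrite /e; field.
have h : 4 < (r + 1) ^+ 2 by nra.
rewrite divr_gt0 // mulr_gt0 // ?exprn_gt0; [by []| lra |].
have -> : (r + 1) ^+ 4 - 16 = ((r + 1) ^+ 2 - 4) * ((r + 1) ^+ 2 + 4) by ring.
by rewrite mulr_gt0 //; lra.
Qed.

(** * Distribution of path lengths *)

Section Lengths.
Variables (k' M : nat).

(** Shares [M] path edges per vertex of the expander equally, the last path taking the remainder;
    the predecessor appears because a path has one edge more than interior vertices. *)
Definition seg_len (i : 'I_k'.+1) : nat :=
  ((M %/ k'.+1).-1 + (if i == ord_max then M %% k'.+1 else 0))%N.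

Lemma seg_len_sum : (k'.+1 <= M)%N -> (\sum_i (seg_len i).+1)%N = M.
Proof.
move=> kM; have L0 : (0 < M %/ k'.+1)%N by rewrite divn_gt0.
transitivity (\sum_(i < k'.+1) (M %/ k'.+1 + if i == ord_max then M %% k'.+1 else 0))%N.
  by apply: eq_bigr => i _; rewrite /seg_len -addSn prednK.
rewrite big_split /= sum_nat_const card_ord -big_mkcond big_pred1_eq.
by rewrite mulnC -divn_eq.
Qed.

Lemma seg_len_ge2 i : (3 * k'.+1 <= M)%N -> (2 <= seg_len i)%N.
Proof.
move=> kM; have : (3 <= M %/ k'.+1)%N by rewrite leq_divRL.
by rewrite /seg_len; lia.
Qed.

Lemma seg_len_lt i : (k'.+1 <= M)%N -> (seg_len i < M %/ k'.+1 + k'.+1)%N.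
Proof.
move=> kM; have : (0 < M %/ k'.+1)%N by rewrite divn_gt0.
have : (M %% k'.+1 < k'.+1)%N by rewrite ltn_mod.
by rewrite /seg_len; case: ifP => _; lia.
Qed.

End Lengths.

(** * The infinite family *)

Lemma infinite_of_unbounded_nverts (A : set sgraph) :
  (forall N, exists2 G, A G & (N <= nverts G)%N) -> infinite_set A.
Proof.
move=> hA /(finite_image nverts)/finite_seqP[s hs].
have [G AG] := hA (sumn s).+1.
have : (nverts @` A)%classic (nverts G) by exists G.
rewrite hs /= => Gs; rewrite ltnNge; apply/negP/negPn.
by elim: s Gs {hs} => //= a s IH; rewrite inE => /orP[/eqP->|/IH]; lia.
Qed.

Theorem theorem1p2 (R : realType) (q : nat) (hq : (3 <= q <= 9)%N) :
  exists m0 : nat, forall m : nat, (m0 <= m)%N ->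
    let d : R := 2 + (q%:R - 2) / m%:R in
    exists eps : R, 0 < eps /\
      infinite_set [set G : sgraph |
        [/\ connected_graph G,
            average_degree R G = d &
            lambda R G 2 / lambda R G (nverts G) >
              (d - 2 * Num.sqrt (d - 1)) / (d + 2 * Num.sqrt (d - 1)) + eps]]%classic.
Proof.
set p := (q - 2)%N; have p7 : (0 < p <= 7)%N by rewrite /p; lia.
have [k' [k'0 /dvdnP[h hk] hV]] := expander_family R p7.
have [p0 p_le7] := andP p7.
have h0 : (0 < h)%N by move: k'0; rewrite hk muln_gt0 => /andP[].
(* Ensures 1000 (k'+1)^2 <= 2 m / p for every p <= 7. *)
exists (4000 * k'.+1 ^ 2)%N => m m_ge d.
have k21 : (k'.+1 <= k'.+1 ^ 2)%N by rewrite expnS leq_pmulr ?expn_gt0.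
have m0 : (0 < m)%N by apply: leq_trans m_ge; rewrite muln_gt0 expn_gt0.
have mR : 0 < m%:R :> R by rewrite ltr0n.
have pR : 0 < p%:R :> R by rewrite ltr0n.
have dE : d = 2 + p%:R / m%:R by rewrite /d /p natrB //; lia.
have := ramanujan_ratio_lt (divr_gt0 pR mR) dE.
set bound := (X in X < _) => bound_lt.
exists (((p%:R / m%:R) ^+ 2 / 16 - bound) / 2); split.
  by rewrite divr_gt0 // subr_gt0.
(* Per vertex of the expander there are M vertices and M + k' edges; as k' = h p, the average degree
   is 2 (M + k') / M = 2 + p / m. *)
pose M := (2 * m * h)%N; pose L := (2 * m %/ p)%N.
have kM : (3 * k'.+1 <= M)%N.
  by apply: (@leq_trans (2 * m)); rewrite ?leq_pmulr //; lia.
have kM1 : (k'.+1 <= M)%N by apply: leq_trans kM; rewrite leq_pmull.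
pose b := @seg_len k' M; have b2 i : (2 <= b i)%N by apply: seg_len_ge2.
have kL : (1000 * k'.+1 ^ 2 <= L)%N.
  rewrite leq_divRL //; apply: leq_trans (leq_mul (leqnn _) p_le7) _; lia.
(* M / k' equals 2 m / p, and dividing by k' + 1 instead leaves room for the remainder as soon as p
   (k'+1)^2 <= 2 m. *)
have bL i : (b i < L)%N.
  apply: leq_trans (seg_len_lt i kM1) _; rewrite leq_divRL //.
  rewrite -(leq_pmul2r (ltn0Sn k')).
  have h1 : (M %/ k'.+1 * k'.+1 <= M)%N by apply: leq_trunc_div.
  have h2 : (M * p = 2 * m * k')%N by rewrite /M hk; ring.
  have h3 : (p * k'.+1 ^ 2 <= 2 * m)%N.
    by apply: leq_trans (leq_mul p_le7 (leqnn _)) _; lia.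
  have h4 := leq_mul h1 (leqnn p).
  have -> : ((M %/ k'.+1 + k'.+1) * p * k'.+1 =
    M %/ k'.+1 * k'.+1 * p + p * k'.+1 ^ 2)%N by ring.
  have -> : (2 * m * k'.+1 = 2 * m * k' + 2 * m)%N by ring.
  by rewrite leq_add // -h2.
(* Chosen so that l (2 m / p)^2 = 2; then l / 8 is the value delta^2 / 16 of
   [ramanujan_ratio_lt]. *)
pose l : R := (p%:R / m%:R) ^+ 2 / 2.
have l0 : 0 < l by rewrite /l divr_gt0 // exprn_gt0 // divr_gt0.
have lL : l * L%:R ^+ 2 <= 2.
  have : L%:R * p%:R <= 2 * m%:R :> R by rewrite -!natrM ler_nat leq_trunc_div.
  rewrite /l; set x := L%:R => hx.
  have -> : (p%:R / m%:R) ^+ 2 / 2 * x ^+ 2 = (x * p%:R) ^+ 2 / (2 * m%:R ^+ 2).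
    by field; rewrite gt_eqF.
  rewrite ler_pdivrMr; last by rewrite mulr_gt0 // exprn_gt0.
  have -> : 2 * (2 * m%:R ^+ 2) = (2 * m%:R) ^+ 2 :> R by ring.
  by rewrite ler_sqr ?nnegrE ?mulr_ge0 // ltW.
apply: infinite_of_unbounded_nverts => N.
have [V [VN [sigma hsig]]] := hV N.+2.
have V0 : (0 < #|V|)%N by apply: leq_trans VN.
have M0 : (0 < M)%N by apply: leq_trans kM1.
have cX : #|vert V b| = (#|V| * M)%N by rewrite card_vert seg_len_sum.
have X_ge : (N.+2 <= #|vert V b|)%N by rewrite cX (leq_trans VN) // leq_pmulr.
(* Orthogonality to this indicator of the first gadget vertices is the mean zero condition on the
   expander. *)
pose phi (x : vert V b) : R := (x == at_ b x.1 ord0 0)%:R.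
have phiE (f : vert V b -> R) : \sum_x phi x * f x = \sum_v f (at_ b v ord0 0).
  rewrite (bigID (fun x : vert V b => x == at_ b x.1 ord0 0)) /= [X in _ + X]big1 ?addr0.
    rewrite (reindex_onto (fun v => at_ b v ord0 0) fst) => [|x /eqP //].
    rewrite [LHS](eq_bigl xpredT) => [|v]; last by rewrite !eqxx.
    by apply: eq_bigr => v _; rewrite /phi eqxx mul1r.
  by move=> x /negPf xn; rewrite /phi xn mul0r.
have [G [nG eG cG rG]] := @graph_of_edges R (vert V b) (edge_type V b)
  (@src V k' b) (@tgt V k' sigma b) l 8 phi (src_tgt sigma b2)
  (@edge_inj V k' sigma b b2) (leq_trans (isT : (1 < N.+2)%N) X_ge) l0
  (@energy_le V k' sigma b R)
  (fun f hf => energy_ge hsig bL kL (ltW l0) lL (etrans (esym (phiE f)) hf)).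
exists G; last by rewrite nG ltnW // ltnW.
split=> //.
  rewrite /average_degree eG nG card_edge_type cX dE hk /M !natrD !natrM.
  field.
  by rewrite !pnatr_eq0 -!lt0n V0 h0 m0.
apply: lt_le_trans rG; rewrite /l -/bound; move: bound_lt.
by move: (_ ^+ 2) => x; lra.
Qed.
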